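(* Let $L>0$, $\beta>0$, and let $f\in C([0,\infty))$ be an increasing function such that $\lim_{s\to\infty} f(s)/s=\infty$. Let $$A_f=\Big\{b\in L^1_{\rm loc}(\mathbb{R})\ \Big|\ b(\cdot+L)=b(\cdot),\ b\ge 0,\ \frac1L\int_0^L f(b)\,dx=\beta\Big\}.$$ Then the functional $b\mapsto c^*(b)$ attains its maximum in $A_f$, i.e. there is $b_*\in A_f$ with $c^*(b_* )=\max_{b\in A_f}c^*(b)$.
   Context: For $\lambda\in\mathbb{R}$ and a real $L$-periodic function $b\in L^1_{\rm loc}(\mathbb{R})$, $k(\lambda,b)\in\mathbb{R}$ denotes the principal eigenvalue of $-L_{\lambda,b}\psi:=-\psi''-2\lambda\psi'-(b(x)+\lambda^2)\psi$ on $\mathbb{R}/L\mathbb{Z}$, i.e. the unique real number for which $-L_{\lambda,b}\psi=k(\lambda,b)\psi$ has an $L$-periodic positive solution $\psi$. For $b\ge0$, $b\not\equiv0$, the minimal speed of pulsating traveling waves of $u_t=u_{xx}+b(x)(1-u)u$ ($x\in\mathbb{R}$, $t>0$) is $c^*(b)=\min_{\lambda>0}\frac{-k(\lambda,b)}{\lambda}$; also $c^*(0)=0$ (the infimum of the same expression).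
   Formalization: The formal theorem additionally assumes that A_f is nonempty (equivalently f(0) ≤ β); without this, e.g. for f(s)=s²+2β, the set A_f is empty and no maximizer exists. *)

(* Defs.v *)
From HB Require Import structures.
From mathcomp Require Import all_boot all_order all_algebra.
From mathcomp Require Import all_classical all_reals all_analysis.

Set Implicit Arguments.
Unset Strict Implicit.
Unset Printing Implicit Defensive.

Import Order.TTheory GRing.Theory Num.Theory.
Import numFieldNormedType.Exports.

Local Open Scope classical_set_scope.
Local Open Scope ring_scope.

Section Defs.
Context {R : realType}.
Notation mu := (@lebesgue_measure R).

(* [h] is the weak derivative of [g], where [g] is taken to be the absolutely
   continuous representative: [g] is an indefinite Lebesgue integral of the
   locally integrable function [h], i.e. [g] is in W^{1,1}_loc and [g' = h]. *)
Definition is_weak_derivative (g h : R -> R) : Prop :=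
  locally_integrable [set: R] h /\
  forall x y, x <= y -> g y - g x = \int[mu]_(t in `[x, y]) h t.

(* Since [b] is only in L^1_loc, a solution of
     - psi'' - 2 lambda psi' - (b + lambda ^ 2) psi = k psi
   is a strong (Caratheodory) solution: psi is in W^{2,1}_loc, hence C^1, and
   the equation holds almost everywhere. *)
Definition is_eigensolution (lambda : R) (b : R -> R) (k : R) (psi : R -> R)
    : Prop :=
  (forall x, derivable psi x 1) /\
  exists2 psi2 : R -> R, is_weak_derivative (derive1 psi) psi2 &
    {ae mu, forall x,
      - psi2 x - 2 * lambda * derive1 psi x - (b x + lambda ^+ 2) * psi x
      = k * psi x}.

Definition is_principal_eigenvalue (L lambda : R) (b : R -> R) (k : R) : Prop :=
  exists psi : R -> R,
    [/\ periodic psi L, forall x, 0 < psi x & is_eigensolution lambda b k psi].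

(* The number k(lambda, b).  For [0 < L] and [b] in L^1_loc and L-periodic,
   exactly one number satisfies [is_principal_eigenvalue], and [xget] selects
   it; the default value 0 is then irrelevant. *)
Definition principal_eigenvalue (L lambda : R) (b : R -> R) : R :=
  xget 0 [set k | is_principal_eigenvalue L lambda b k].

(* The infimum is a minimum unless [b] vanishes almost everywhere, in which case
   k(lambda, b) = - lambda ^ 2 and the infimum is 0. *)
Definition minimal_speed (L : R) (b : R -> R) : R :=
  inf [set - principal_eigenvalue L lambda b / lambda | lambda in
        [set lambda : R | 0 < lambda]].

(* Members of L^1_loc are given by Borel representatives that are periodic and
   nonnegative everywhere; each class with these properties almost everywhere
   has one, and [minimal_speed] depends only on the class.  The integral is
   extended-real valued and the negative part of [f \o b] is bounded when [f] is
   nondecreasing, so the constraint forces [f \o b] to be integrable over a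
   period. *)
Definition admissible (L beta : R) (f : R -> R) : set (R -> R) :=
  [set b | [/\ locally_integrable [set: R] b, periodic b L,
    forall x, 0 <= b x &
    ((L^-1)%:E * \int[mu]_(x in `[0%R, L]) (f (b x))%:E = beta%:E)%E]].

End Defs.

(* Main.v *)
(* Take as test functions the positive L-periodic C^1 functions w with
   int_0^L w = 1, and put A(w) = L^2 / int 1/w and
   B(w, b) = int b w - int w'^2 / (4 w).  Testing the Riccati equation
   satisfied by psi'/psi + lambda against w gives the variational formula
   - k(lambda, b) = max_w (lambda^2 A(w) + B(w, b)).  Since A and B are concave
   in w, minimum and maximum can be exchanged, and
   c^*(b)^2 = 4 sup_w A(w) B(w, b).

   Let (w_n, b_n) be a maximizing sequence for A(w) B(w, b) over test functions
   and admissible b.  As f is superlinear, int b is bounded on the admissible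
   set, hence the w_n are bounded and uniformly 1/2-Holder and cluster at some
   continuous w >= 0.  The linear functional b |-> int b w attains its maximum
   over the admissible set, at a bounded bstar found with a Lagrange multiplier.
   Then B(w_n, bstar) >= B(w_n, b_n) - o(1), so no convergence of b_n is needed
   and bstar is optimal.  Only bstar needs to have principal eigenvalues: if
   k(lambda, b) did not exist, its default value 0 could only lower the speed
   of b. *)

Require Import Defs.
From HB Require Import structures.
From mathcomp Require Import all_boot all_order all_algebra.
From mathcomp Require Import all_classical all_reals all_analysis.
From mathcomp Require Import measurable_realfun ring lra.
Import Order.TTheory GRing.Theory Num.Theory.
Import numFieldNormedType.Exports.
Local Open Scope classical_set_scope.
Local Open Scope ring_scope.

Set Implicit Arguments.
Unset Strict Implicit.
Unset Printing Implicit Defensive.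

(** * Indefinite Lebesgue integrals *)

(** The cluster point [w] may vanish on part of the period, so neither A nor B is ever evaluated at
    it: [w] only selects [bstar], and optimality is tested along the [w_n]. To this end the two
    halves of the variational formula are used asymmetrically. A competitor [b], merely integrable,
    needs test functions that attain the eigenvalue; they are built from eigenfunctions, which exist
    because only competitors of positive speed matter. For [bstar] the inequality -k >= l^2 A(w_n) +
    B(w_n, bstar) and the AM-GM bound by 2 l sqrt(A B) suffice, but its eigenvalues must be shown to
    exist. Its boundedness allows an elementary proof: the operator splits into two periodic
    first-order problems, and compactness and comparison at the largest [k] with a subsolution
    replace spectral theory. The exchange of minimum and maximum is needed only up to an error [e],
    since only suprema of A B enter. *)

Section LocallyIntegrable.
Context {R : realType}.
Notation mu := (@lebesgue_measure R).
Notation li := (@locally_integrable R [set: R]).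
Implicit Types (f g h : R -> R) (a b c : R).

Lemma li_measurable h : li h -> measurable_fun setT h.
Proof. by case. Qed.

Lemma li_integrable h a b : li h -> mu.-integrable `[a, b] (EFin \o h).
Proof.
move=> [mh _ ih]; apply/integrableP; split.
  by apply/measurable_EFinP; exact: measurable_funS mh.
by apply: ih => //; exact: segment_compact.
Qed.

Lemma measurable_segment_integrable_li h : measurable_fun setT h ->
  (forall a b, mu.-integrable `[a, b] (EFin \o h)) -> li h.
Proof.
move=> mh ih; split => //; first exact: openT.
move=> K _ cK.
have [M [_ KM]] := compact_bounded cK.
have /integrableP[_ foo] := ih (- (M + 1)) (M + 1).
apply: le_lt_trans foo; apply: ge0_subset_integral => //=.
- exact: compact_measurable.
- apply/measurable_EFinP; apply: measurableT_comp => //.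
  exact: measurable_funTS.
- move=> x Kx; rewrite /= in_itv/= -ler_norml.
  by apply: (KM (M + 1)) => //; rewrite ltrDl.
Qed.

Lemma li_le f g : measurable_fun setT f -> li g ->
  (forall x, `|f x| <= `|g x|) -> li f.
Proof.
move=> mf lg fg; apply: measurable_segment_integrable_li => // a b.
apply: (@le_integrable _ _ _ mu _ _ _ (EFin \o g)) => //.
- by apply/measurable_EFinP; exact: measurable_funS mf.
- by move=> x _ /=; rewrite lee_fin.
- exact: li_integrable.
Qed.

Lemma li_continuous h : continuous h -> li h.
Proof.
move=> ch; apply: measurable_segment_integrable_li.
  exact: continuous_measurable_fun.
move=> a b; apply: continuous_compact_integrable; first exact: segment_compact.
exact: continuous_subspaceT.
Qed.

Lemma li_cst c : li (fun=> c).
Proof. by apply: li_continuous => x; exact: cvg_cst. Qed.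

Lemma li_bounded h M : measurable_fun setT h -> (forall x, `|h x| <= M) -> li h.
Proof.
move=> mh hM; apply: (li_le mh (li_cst M)) => x.
by rewrite (le_trans (hM x))// ler_norm.
Qed.

Lemma liD f g : li f -> li g -> li (fun x => f x + g x).
Proof. exact: locally_integrableD. Qed.

Lemma liN f : li f -> li (fun x => - f x).
Proof. by move=> ?; exact: locally_integrableN. Qed.

Lemma liB f g : li f -> li g -> li (fun x => f x - g x).
Proof. by move=> lf lg; apply: liD => //; exact: liN. Qed.

Lemma li_norm f : li f -> li (fun x => `|f x|).
Proof.
move=> lf; apply: (li_le _ lf) => [|x]; last by rewrite normr_id.
by apply: measurableT_comp => //; exact: li_measurable.
Qed.

Lemma liM_continuous f g : continuous g -> li f -> li (fun x => g x * f x).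
Proof.
move=> cg lf.
have mgf : measurable_fun setT (fun x => g x * f x).
  apply: measurable_funM; first exact: continuous_measurable_fun.
  exact: li_measurable.
apply: measurable_segment_integrable_li => // a b.
have [M [_ gM]] : bounded_set (g @` `[a, b]).
  apply: compact_bounded; apply: continuous_compact; last exact: segment_compact.
  exact: continuous_subspaceT.
apply: (@le_integrable _ _ _ mu _ _ _ (EFin \o (fun x => (`|M| + 1) * f x))) => //.
- by apply/measurable_EFinP; exact: measurable_funS mgf.
- move=> x xab /=; rewrite lee_fin !normrM ler_wpM2r//.
  rewrite [leRHS]ger0_norm ?addr_ge0//; apply: (gM (`|M| + 1)) => //=.
    by rewrite (le_lt_trans (ler_norm _))// ltrDl.
  by exists x.
- rewrite (_ : EFin \o _ = (fun x => (`|M| + 1)%:E * (EFin \o f) x)%E)//.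
  by apply: integrableZl => //; exact: li_integrable.
Qed.

Lemma liZ f c : li f -> li (fun x => c * f x).
Proof. by apply: liM_continuous => x; exact: cvg_cst. Qed.

Lemma int_le f g a b : li f -> li g ->
  (forall x, a <= x <= b -> f x <= g x) ->
  \int[mu]_(t in `[a, b]) f t <= \int[mu]_(t in `[a, b]) g t.
Proof.
move=> lf lg fg; apply: le_Rintegral; [by []|exact: li_integrable..|].
by move=> x; rewrite /= in_itv/=; exact: fg.
Qed.

Lemma int_ge0 f a b :
  (forall x, a <= x <= b -> 0 <= f x) -> 0 <= \int[mu]_(t in `[a, b]) f t.
Proof. by move=> fg; apply: Rintegral_ge0 => x; rewrite /= in_itv/=; exact: fg. Qed.

Lemma eq_int f g a b : (forall x, a <= x <= b -> f x = g x) ->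
  \int[mu]_(t in `[a, b]) f t = \int[mu]_(t in `[a, b]) g t.
Proof.
move=> fg; apply: eq_Rintegral => x; rewrite inE/= in_itv/=; exact: fg.
Qed.

Lemma intD f g a b : li f -> li g ->
  \int[mu]_(t in `[a, b]) (f t + g t) =
  \int[mu]_(t in `[a, b]) f t + \int[mu]_(t in `[a, b]) g t.
Proof. by move=> lf lg; apply: RintegralD => //; exact: li_integrable. Qed.

Lemma intB f g a b : li f -> li g ->
  \int[mu]_(t in `[a, b]) (f t - g t) =
  \int[mu]_(t in `[a, b]) f t - \int[mu]_(t in `[a, b]) g t.
Proof. by move=> lf lg; apply: RintegralB => //; exact: li_integrable. Qed.

Lemma intZ f a b c : li f ->
  \int[mu]_(t in `[a, b]) (c * f t) = c * \int[mu]_(t in `[a, b]) f t.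
Proof. by move=> lf; apply: RintegralZl => //; exact: li_integrable. Qed.

Lemma int_cst a b c : a <= b -> \int[mu]_(t in `[a, b]) c = c * (b - a).
Proof. move=> ab; rewrite Rintegral_cst//=; congr (_ * _).
have -> : mu `[a, b] = (b - a)%:E.
  rewrite lebesgue_measure_itv/= lte_fin.
  by case: ltgtP ab => //= -> _; rewrite subrr.
by []. Qed.

Lemma int_split f a b c : li f -> a <= b -> b <= c ->
  \int[mu]_(t in `[a, c]) f t =
  \int[mu]_(t in `[a, b]) f t + \int[mu]_(t in `[b, c]) f t.
Proof.
move=> lf ab bc; apply/eqP; rewrite addrC -subr_eq; apply/eqP.
rewrite Rintegral_itvB ?bnd_simp//; last exact: li_integrable.
rewrite Rintegral_itv_obnd_cbnd//.
by apply: integrableS (li_integrable b c lf) => //; apply: subset_itvr; rewrite bnd_simp.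
Qed.

Lemma int_norm f a b : li f ->
  `|\int[mu]_(t in `[a, b]) f t| <= \int[mu]_(t in `[a, b]) `|f t|.
Proof. by move=> lf; apply: le_normr_Rintegral => //; exact: li_integrable. Qed.

Lemma int_point f a : \int[mu]_(t in `[a, a]) f t = 0.
Proof. by rewrite set_itv1 Rintegral_set1. Qed.

Lemma ae_eq_int f g a b : li f -> li g ->
  {ae mu, forall x, f x = g x} ->
  \int[mu]_(t in `[a, b]) f t = \int[mu]_(t in `[a, b]) g t.
Proof.
move=> lf lg fg; rewrite /Rintegral; congr fine; apply: ae_eq_integral => //.
- by apply/measurable_EFinP; exact: measurable_funTS (li_measurable lf).
- by apply/measurable_EFinP; exact: measurable_funTS (li_measurable lg).
- apply: filterS fg; first exact: (ae_filter_ringOfSetsType mu).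
  by move=> x fgx _; rewrite fgx.
Qed.

End LocallyIntegrable.

(** * Calculus of indefinite integrals and the product rule *)

Section WeakDerivative.
Context {R : realType}.
Notation mu := (@lebesgue_measure R).
Notation li := (@locally_integrable R [set: R]).
Notation wd := (@is_weak_derivative R).
Implicit Types (f g h F G : R -> R) (a b c x y : R).

Lemma continuous_distP g z : {for z, continuous g} <->
  forall e, 0 < e -> exists2 d, 0 < d & forall t, `|t - z| < d -> `|g t - g z| < e.
Proof.
split=> [cg e e0|cg].
  have /cvgrPdist_lt/(_ e e0)/nbhs_ballP[d /= d0 gd] := cg.
  exists d => // t td; rewrite distrC; apply: gd.
  by rewrite /ball/= distrC.
apply/cvgrPdist_lt => e e0; have [d d0 gd] := cg e e0.
apply/nbhs_ballP; exists d => //= t; rewrite /ball/= distrC => td.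
by rewrite distrC; exact: gd.
Qed.

Lemma wd_exists h c v : li h -> exists2 g, wd g h & g c = v.
Proof.
move=> lh; pose G x := if c <= x then \int[mu]_(t in `[c, x]) h t
  else - \int[mu]_(t in `[x, c]) h t.
exists (fun x => v + G x); last by rewrite /G lexx int_point addr0.
split=> // x y xy; rewrite opprD addrACA subrr add0r /G.
have [cx|xc] := leP c x.
  rewrite (le_trans cx xy) (int_split lh cx xy); ring.
have [cy|yc] := leP c y.
  rewrite (int_split lh (ltW xc) cy); ring.
rewrite (int_split lh xy (ltW yc)); ring.
Qed.

Lemma wd_itv g h a x : wd g h -> a <= x ->
  g x = g a + \int[mu]_(t in `[a, x]) h t.
Proof. by move=> [_ gh] ax; rewrite -(gh _ _ ax); ring. Qed.

Lemma wd_continuous g h : wd g h -> continuous g.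
Proof.
move=> [lh gh] x.
have x1 : x - 1 < x + 1 by lra.
apply: (@within_continuous_continuous _ _ _ (x - 1) (x + 1)) => //; last first.
  by rewrite in_itv/=; apply/andP; split; lra.
have c0 := parameterized_integral_continuous (ltW x1) (li_integrable _ _ lh).
have : {within `[x - 1, x + 1], continuous (fun y => g (x - 1) +
   \int[mu]_(t in `[x - 1, y]) h t)}.
  by move=> z; apply: cvgD; [exact: cvg_cst|exact: c0].
apply: subspace_eq_continuous => z; rewrite inE/= in_itv/= => /andP[z1 _].
exact: (esym (wd_itv (conj lh gh) z1)).
Qed.

Lemma wd_derive g h x : wd g h -> {for x, continuous h} -> is_derive x 1 g (h x).
Proof.
move=> gh cx; have lh := gh.1.
have [] := @continuous_FTC1_closed R h (x - 1) x (x + 1) _ _ _ cx.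
- by rewrite ltrDl.
- exact: li_integrable.
- by rewrite gtrBl.
set F := (fun y => _) => dF F'x.
have dF' : is_derive x 1 F (h x).
  by apply: DeriveDef; [exact: dF|rewrite -derive1E].
have dG : is_derive x 1 (fun y => g (x - 1) + F y) (h x).
  rewrite -[X in is_derive _ _ _ X]add0r.
  exact: is_deriveD.
apply: near_eq_is_derive dG.
apply/nbhs_ballP; exists 1 => //= y.
rewrite /ball/= ltr_norml => /andP[y1 y2].
by rewrite /F (wd_itv gh (x := y) (a := x - 1))//; lra.
Qed.

Lemma is_derive_continuous g (dg : R) x : is_derive x 1 g dg -> {for x, continuous g}.
Proof.
move=> [dgx _]; apply: differentiable_continuous.
exact/derivable1_diffP.
Qed.

Lemma derive_wd g h : (forall x, is_derive x (1 : R) g (h x)) -> continuous h -> wd g h.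
Proof.
move=> gh ch; split; first exact: li_continuous.
move=> x y; rewrite le_eqVlt => /predU1P[->|xy]; first by rewrite int_point subrr.
have cg : continuous g by move=> z; exact: is_derive_continuous (gh z).
rewrite /Rintegral (continuous_FTC2 (F := g))//.
- exact: continuous_subspaceT.
- split => [z _||].
  + by case: (gh z).
  + exact/cvg_at_right_filter/cg.
  + exact/cvg_at_left_filter/cg.
- by move=> z _; rewrite derive1E; have [_ ->] := gh z.
Qed.

Lemma wdD g1 g2 h1 h2 : wd g1 h1 -> wd g2 h2 ->
  wd (fun x => g1 x + g2 x) (fun x => h1 x + h2 x).
Proof.
move=> [l1 w1] [l2 w2]; split; first exact: liD.
by move=> x y xy; rewrite intD// -w1// -w2//; ring.
Qed.

Lemma wdZ g h c : wd g h -> wd (fun x => c * g x) (fun x => c * h x).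
Proof.
move=> [l w]; split; first exact: liZ.
by move=> x y xy; rewrite intZ// -w//; ring.
Qed.

Lemma wd_cst c : wd (fun=> c) (fun=> 0).
Proof.
split; first exact: li_cst.
by move=> x y xy; rewrite int_cst// mul0r subrr.
Qed.

Lemma wdB g1 g2 h1 h2 : wd g1 h1 -> wd g2 h2 ->
  wd (fun x => g1 x - g2 x) (fun x => h1 x - h2 x).
Proof.
move=> w1 w2; have := wdD w1 (wdZ (- 1) w2).
by under eq_fun do rewrite mulN1r; under [X in wd _ X]eq_fun do rewrite mulN1r.
Qed.

Lemma wd_homo g h : wd g h -> (forall x, 0 <= h x) -> {homo g : x y / x <= y}.
Proof. by move=> [_ gh] h0 x y xy; rewrite -subr_ge0 gh// int_ge0. Qed.

Lemma wd_unique g1 g2 h c : wd g1 h -> wd g2 h -> g1 c = g2 c -> g1 =1 g2.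
Proof.
move=> [_ w1] [_ w2] e x; have [cx|/ltW xc] := leP c x.
  by have := w1 _ _ cx; have := w2 _ _ cx; lra.
by have := w1 _ _ xc; have := w2 _ _ xc; lra.
Qed.

Lemma wd_ae g h1 h2 : li h2 -> wd g h1 -> {ae mu, forall x, h1 x = h2 x} -> wd g h2.
Proof.
move=> l2 [l1 w] e; split => // x y xy.
by rewrite w//; apply: ae_eq_int.
Qed.

(* The hypothesis only concerns intervals straddling [z], which suffices for a
   supremum argument. *)
Lemma increment_le_straddle (P N : R -> R) (e x y : R) : x <= y ->
  (forall z, x <= z <= y -> exists2 d, 0 < d &
    forall s t, x <= s -> z - d < s -> s <= z -> z <= t -> t < z + d ->
    `|P t - P s| <= e * (N t - N s)) ->
  `|P y - P x| <= e * (N y - N x).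
Proof.
move=> xy loc.
pose S := [set t | x <= t <= y /\ `|P t - P x| <= e * (N t - N x)].
have S0 : S x by split; [rewrite lexx|rewrite !subrr mulr0 normr0].
have uS : ubound S y by move=> t [/andP[]].
have hS : has_sup S by split; [exists x|exists y].
have xc : x <= sup S by apply: ub_le_sup => //; case: hS.
have cy : sup S <= y by apply: ge_sup => //; exists x.
have [d d0 Pd] := loc (sup S) (introT andP (conj xc cy)).
have [s Ss sd] := sup_adherent d0 hS.
have sc : s <= sup S by apply: ub_le_sup => //; case: hS.
have key t : sup S <= t -> t < sup S + d -> `|P t - P x| <= e * (N t - N x).
  move=> ct td; have [/andP[xs _] Px] := Ss.
  have := Pd s t xs sd sc ct td.
  have := ler_normD (P t - P s) (P s - P x).
  by rewrite (_ : P t - P s + (P s - P x) = P t - P x); [nra|ring].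
have [yd|dy] := ltP y (sup S + d); first exact: key.
have : sup S + d / 2 <= sup S.
  apply: ub_le_sup; first by case: hS.
  split; first by apply/andP; split; lra.
  by apply: key; lra.
lra.
Qed.

(** Compare [F * G] with a primitive [K] of the candidate derivative. Over a short interval the
    increment of the difference [P] is the integral of [(G t - G u) * f u + (F s - F u) * g u],
    hence at most [e] times the increment of a primitive [N] of [|f| + |g|]. Letting [e] tend to 0
    shows that [P] is constant, with no differentiation almost everywhere. *)
Lemma wdM F G f g : wd F f -> (forall x, is_derive x (1 : R) G (g x)) -> continuous g ->
  wd (fun x => F x * G x) (fun x => G x * f x + F x * g x).
Proof.
move=> wF dG cg; have lf := wF.1.
have cF := wd_continuous wF.
have cG : continuous G by move=> z; exact: is_derive_continuous (dG z).
have wG := derive_wd dG cg.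
have lg := wG.1.
have lh : li (fun x => G x * f x + F x * g x).
  by apply: liD; exact: liM_continuous.
have lN : li (fun x => `|f x| + `|g x|) by apply: liD; exact: li_norm.
have [K wK _] := wd_exists 0 0 lh.
have [N wN _] := wd_exists 0 0 lN.
split => // x y xy; rewrite -wK.2//.
pose P z := F z * G z - K z.
have main e : 0 < e -> `|P y - P x| <= e * (N y - N x).
  move=> e0; apply: increment_le_straddle => // z _.
  have e20 : 0 < e / 2 by lra.
  have [d1 d10 Fd] := (continuous_distP F z).1 (cF z) _ e20.
  have [d2 d20 Gd] := (continuous_distP G z).1 (cG z) _ e20.
  exists (Num.min d1 d2); first by rewrite lt_min d10.
  move=> s t _ zs sz zt td; have st := le_trans sz zt.
  have close u : s <= u <= t -> `|u - z| < d1 /\ `|u - z| < d2.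
    move=> /andP[su ut]; apply/andP; rewrite -lt_min ltr_norml.
    by apply/andP; split; lra.
  have dGG u : s <= u <= t -> `|G t - G u| <= e.
    move=> uI; have /Gd := (close u uI).2.
    have /Gd : `|t - z| < d2 by apply: (close t _).2; rewrite st lexx.
    rewrite !ltr_norml ler_norml => /andP[? ?] /andP[? ?].
    by apply/andP; split; lra.
  have dFF u : s <= u <= t -> `|F s - F u| <= e.
    move=> uI; have /Fd := (close u uI).1.
    have /Fd : `|s - z| < d1 by apply: (close s _).1; rewrite st lexx.
    rewrite !ltr_norml ler_norml => /andP[? ?] /andP[? ?].
    by apply/andP; split; lra.
  have lA : li (fun u => (G t - G u) * f u).
    apply: liM_continuous => // u; apply: cvgB; [exact: cvg_cst|exact: cG].
  have lB : li (fun u => (F s - F u) * g u).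
    apply: liM_continuous => // u; apply: cvgB; [exact: cvg_cst|exact: cF].
  have -> : P t - P s =
      \int[mu]_(u in `[s, t]) ((G t - G u) * f u + (F s - F u) * g u).
    rewrite (@eq_int _ _ (fun u => (G t * f u + F s * g u) -
      (G u * f u + F u * g u))); last by move=> u _; ring.
    rewrite intB//; last by apply: liD; exact: liZ.
    rewrite intD//; [|exact: liZ|exact: liZ].
    rewrite intZ// intZ// -wF.2// -wG.2// -wK.2// /P; ring.
  apply: le_trans (int_norm _ _ _) _; first exact: liD.
  rewrite wN.2// -intZ//; apply: int_le.
  - by apply: li_norm; exact: liD.
  - exact: liZ.
  - move=> u uI; apply: le_trans (ler_normD _ _) _.
    by rewrite !normrM mulrDr lerD// ler_wpM2r// ?dGG ?dFF.
suff : P y - P x = 0 by rewrite /P; lra.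
apply/eqP; rewrite -normr_le0; apply/ler_addgt0Pl => e e0; rewrite addr0.
have N0 : 0 <= N y - N x.
  by rewrite wN.2//; apply: int_ge0 => u _; exact: addr_ge0.
have := main (e / (N y - N x + 1)) (divr_gt0 e0 (ltr_wpDl N0 ltr01)).
move=> /le_trans; apply; rewrite -mulrA ger_pMr// mulrC ler_pdivrMr; lra.
Qed.

End WeakDerivative.

(** * Translation invariance of the integral *)

Section Translation.
Context {R : realType}.
Notation mu := (@lebesgue_measure R).
Notation li := (@locally_integrable R [set: R]).
Notation wd := (@is_weak_derivative R).
Variable c : R.
Let shift : measurableTypeR R -> measurableTypeR R := fun x : R => x + c.

Let measurable_shift : measurable_fun [set: measurableTypeR R] shift.
Proof. exact: measurable_funD. Qed.

Let nu : {measure set (measurableTypeR R) -> \bar R} :=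
  measure_function_pushforward__canonical__measure_function_Measure
    mu measurable_shift.

Let preimage_shift a b : shift @^-1` `[a + c, b + c] = `[a, b]%classic.
Proof. by apply/seteqP; split=> x; rewrite /= !in_itv/= /shift !lerD2r. Qed.

Lemma lebesgue_measure_shift (A : set (measurableTypeR R)) : measurable A ->
  mu A = pushforward mu shift A.
Proof.
apply: (@lebesgue_measure_unique R nu) => _ [[a b] _ <-]/=.
rewrite /pushforward (_ : shift @^-1` _ = `]a - c, b - c]%classic).
  rewrite !lebesgue_measure_itv/= !lte_fin ltrD2r -!EFinD.
  by rewrite (_ : b - c - (a - c) = b - a)//; ring.
by apply/seteqP; split=> x; rewrite /= !in_itv/= /shift ltrBlDr lerBrDr.
Qed.

Lemma ge0_integral_shift (h : R -> \bar R) a b : measurable_fun setT h ->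
  (forall x, 0 <= h x)%E ->
  (\int[mu]_(x in `[(a + c)%R, (b + c)%R]) h x = \int[mu]_(x in `[a, b]) h (x + c)%R)%E.
Proof.
move=> mh h0; rewrite (@eq_measure_integral _ _ _ _ nu); last first.
  by move=> A mA _; exact: lebesgue_measure_shift.
rewrite ge0_integral_pushforward//; last exact: measurable_funTS.
by rewrite preimage_shift.
Qed.

Lemma li_shift h : li h -> li (fun x => h (x + c)).
Proof.
move=> lh; have mh := li_measurable lh.
have mhc : measurable_fun [set: R] (fun x : R => h (x + c)).
  exact: measurableT_comp mh measurable_shift.
apply: measurable_segment_integrable_li => // a b.
apply/integrableP; split; first exact/measurable_EFinP/measurable_funTS.
rewrite -(ge0_integral_shift (h := fun x => `|(h x)%:E|%E))//; last first.
  by apply/measurable_EFinP; exact: measurableT_comp.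
by have /integrableP[] := li_integrable (a + c) (b + c) lh.
Qed.

Lemma int_shift h a b : li h ->
  \int[mu]_(x in `[a + c, b + c]) h x = \int[mu]_(x in `[a, b]) h (x + c).
Proof.
move=> lh; have lhc := li_shift lh.
rewrite /Rintegral (@eq_measure_integral _ _ _ _ nu); last first.
  by move=> A mA _; exact: lebesgue_measure_shift.
rewrite integral_pushforward//.
- by rewrite preimage_shift.
- by apply/measurable_EFinP; exact: li_measurable.
- by rewrite preimage_shift; exact: (li_integrable a b lhc).
Qed.

Lemma wd_shift g h : wd g h -> wd (fun x => g (x + c)) (fun x => h (x + c)).
Proof.
move=> [lh gh]; split; first exact: li_shift.
by move=> x y xy; rewrite gh ?lerD2r// int_shift.
Qed.

End Translation.

(** * Ascoli's theorem for sequences *)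

Section Compactness.
Context {R : realType}.

(** By Tychonoff the sequence has a cluster point in the product topology. The index set may be
    uncountable, so no pointwise convergent subsequence can be expected; a cluster point only gives
    approximation at finitely many points by arbitrarily late terms. *)
Lemma bounded_seq_pointwise_cluster (T : choiceType) (M : R) (u : nat -> T -> R) :
  (forall n x, `|u n x| <= M) ->
  exists g : T -> R, forall (s : seq T) (e : R) (N : nat), 0 < e ->
    exists2 n, (N <= n)%N & forall x, x \in s -> `|u n x - g x| < e.
Proof.
move=> uM.
have := @tychonoff T (fun=> (R : topologicalType)) (fun=> `[- M, M]%classic)
  (fun=> @segment_compact R (- M) M).
move=> /(_ (u @ \oo) _)[].
  by exists 0%N => // n _ /= x; rewrite in_itv/= -ler_norml; exact: uM.
move=> g [_ gcl]; exists g => s e N e0.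
pose A := [set f : T -> R | exists2 n, (N <= n)%N & f = u n].
have FA : (u @ \oo) A.
  by exists N => // n /= Nn; exists n.
have FB : nbhs g [set f : T -> R | forall x, x \in s -> `|f x - g x| < e].
  elim: s => [|x s IH]; first exact: filterE.
  have Bx : nbhs g [set f : T -> R | `|f x - g x| < e].
    have := @proj_continuous T (fun=> (R : topologicalType)) x g.
    move=> /(_ [set r : R | `|r - g x| < e]); apply.
    by apply/nbhs_ballP; exists e => //= r; rewrite /ball/= distrC.
  apply: filterS (filterI Bx IH) => f [/= fx fs] y.
  by rewrite inE => /predU1P[->//|]; exact: fs.
have [f [[n Nn ->] Bf]] := gcl _ _ FA FB.
by exists n.
Qed.

(** Closeness on a finite grid of mesh below [d] spreads to the whole interval. With all tolerances
    equal to [e / 5], the cluster point inherits the modulus [3 / 5 * e], and [e / 5], [e / 5] and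
    [3 / 5 * e] add up to [e]. *)
Lemma ascoli_cluster (L M : R) (u : nat -> R -> R) : 0 < L ->
  (forall n x, 0 <= x <= L -> `|u n x| <= M) ->
  (forall e, 0 < e -> exists2 d, 0 < d & forall n x y, 0 <= x <= L -> 0 <= y <= L ->
     `|x - y| < d -> `|u n x - u n y| <= e) ->
  exists g : R -> R, forall e N, 0 < e ->
    exists2 n, (N <= n)%N & forall x, 0 <= x <= L -> `|u n x - g x| <= e.
Proof.
move=> L0 uM ue.
have M0 : 0 <= M by rewrite (le_trans _ (uM 0%N 0 _))// lexx ltW.
pose v n x := if 0 <= x <= L then u n x else 0.
have [|g gP] := @bounded_seq_pointwise_cluster R M v.
  by move=> n x; rewrite /v; case: ifPn => [/uM//|_]; rewrite normr0.
exists g => e N e0.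
have [|d d0 ud] := ue (e / 5); first lra.
have ge x y : 0 <= x <= L -> 0 <= y <= L -> `|x - y| < d -> `|g x - g y| <= 3 / 5 * e.
  move=> xL yL xy; have [|n _ vg] := gP [:: x; y] (e / 5) 0%N; first lra.
  have := vg x; have := vg y; rewrite !inE !eqxx orbT /v xL yL => /(_ isT) vy /(_ isT) vx.
  have := ud n x y xL yL xy; move: vx vy.
  rewrite !ltr_norml !ler_norml => /andP[? ?] /andP[? ?] /andP[? ?].
  by apply/andP; split; lra.
pose m := (Num.truncn (L / d)).+1.
have mL : L / d < m%:R by rewrite /m truncnS_gt.
have m0 : 0 < m%:R :> R by rewrite ltr0n.
have mLd : L / m%:R < d by rewrite ltr_pdivrMr// mulrC -ltr_pdivrMr.
have [|n Nn vg] := gP [seq k%:R * (L / m%:R) | k <- iota 0 m.+1] (e / 5) N; first lra.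
exists n => // x /andP[x0 xL].
pose k := Num.truncn (x / (L / m%:R)).
have Lm0 : 0 < L / m%:R by rewrite divr_gt0.
have xm0 : 0 <= x / (L / m%:R) by rewrite divr_ge0// ltW.
have /andP[k1 k2] := truncn_itv xm0.
have kx : k%:R * (L / m%:R) <= x by rewrite -ler_pdivlMr.
have xk : x < k.+1%:R * (L / m%:R) by rewrite -ltr_pdivrMr.
have km : (k <= m)%N.
  rewrite -(ler_nat R); apply: le_trans k1 _.
  rewrite ler_pdivrMr// mulrC divfK//; exact: lt0r_neq0.
set t := k%:R * (L / m%:R).
have tL : 0 <= t <= L.
  by apply/andP; split; [rewrite mulr_ge0// ltW|exact: le_trans kx xL].
have xt : `|x - t| < d.
  move: xk; rewrite -natr1 mulrDl mul1r -/t => xk.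
  by rewrite ger0_norm ?subr_ge0//; lra.
have := vg t; rewrite /v tL => /(_ _)/wrap[].
  by apply/mapP; exists k => //; rewrite mem_iota.
have xL' : 0 <= x <= L by rewrite x0.
have := ud n x t xL' tL xt; have := ge x t xL' tL xt.
rewrite !ltr_norml !ler_norml => /andP[? ?] /andP[? ?] /andP[? ?].
by apply/andP; split; lra.
Qed.

End Compactness.

(** * Existence of the principal eigenvalue for bounded potentials *)

Section Calculus.
Context {R : realType}.
Implicit Types (f g : R -> R) (x L : R).

Lemma is_derive1M f g x df dg : is_derive x (1 : R) f df -> is_derive x (1 : R) g dg ->
  is_derive x (1 : R) (fun y => f y * g y) (df * g x + f x * dg).
Proof.
move=> hf hg; have := is_deriveM hf hg.
by move=> /is_derive_eq; apply; rewrite /GRing.scale/= addrC mulrC.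
Qed.

Lemma is_derive1D f g x df dg : is_derive x (1 : R) f df -> is_derive x (1 : R) g dg ->
  is_derive x (1 : R) (fun y => f y + g y) (df + dg).
Proof. by move=> hf hg; exact: (is_deriveD hf hg). Qed.

Lemma is_derive1Z f x df c : is_derive x (1 : R) f df ->
  is_derive x (1 : R) (fun y => c * f y) (c * df).
Proof. by move=> hf; exact: (is_deriveZ c hf). Qed.

Lemma is_derive1_expRM c x : is_derive x (1 : R) (fun y => expR (c * y)) (c * expR (c * x)).
Proof.
have h : is_derive x (1 : R) (fun y => c * y) c.
  by have := is_derive1Z c (is_derive_id x (1 : R)); rewrite mulr1.
have := @is_derive1_comp R expR _ x _ _ (is_derive_expR (c * x)) h.
by move/is_derive_eq; apply; rewrite mulrC.
Qed.

Lemma continuous_expRM c : continuous (fun y : R => expR (c * y)).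
Proof. by move=> x; exact: is_derive_continuous (is_derive1_expRM c x). Qed.

Lemma continuousM_fun f g : continuous f -> continuous g ->
  continuous (fun x => f x * g x).
Proof. by move=> cf cg x; apply: cvgM; [exact: cf|exact: cg]. Qed.

Lemma continuousD_fun f g : continuous f -> continuous g ->
  continuous (fun x => f x + g x).
Proof. by move=> cf cg x; apply: cvgD; [exact: cf|exact: cg]. Qed.

Lemma continuousB_fun f g : continuous f -> continuous g ->
  continuous (fun x => f x - g x).
Proof. by move=> cf cg x; apply: cvgB; [exact: cf|exact: cg]. Qed.

Lemma continuous_cst_fun (c : R) : continuous (fun _ : R => c).
Proof. by move=> x; exact: cvg_cst. Qed.

Lemma continuousZ_fun c f : continuous f -> continuous (fun x => c * f x).
Proof. by move=> cf; apply: continuousM_fun => //; exact: continuous_cst_fun. Qed.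

Definition fold_period L x : R := x - L * (Num.floor (x / L))%:~R.

Lemma fold_period_itv L x : 0 < L -> 0 <= fold_period L x < L.
Proof.
move=> L0; have /andP[h1 h2] := floor_itv (x / L).
rewrite /fold_period subr_ge0 ltrBlDl mulrC -ler_pdivlMr// h1/=.
rewrite [ltRHS](_ : _ = ((Num.floor (x / L))%:~R + 1) * L); last by ring.
by rewrite -ltr_pdivrMr// -[1]/(1%:~R) -intrD.
Qed.

Lemma periodic_int L f (k : int) x : periodic f L -> f (x + L * k%:~R) = f x.
Proof.
move=> pf; case: k => n.
  by have := periodicn pf n x; rewrite -mulr_natr.
rewrite NegzE mulrNz mulrN -(periodicn pf n.+1 (x - _)) -mulr_natr.
by rewrite subrK.
Qed.

Lemma periodic_fold L f x : periodic f L -> f (fold_period L x) = f x.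
Proof.
by move=> pf; rewrite /fold_period -mulrN -mulrNz periodic_int.
Qed.

Lemma fold_period_periodic L x : 0 < L -> fold_period L (x + L) = fold_period L x.
Proof.
move=> L0; rewrite /fold_period mulrDl divff ?gt_eqF//.
by rewrite floorDrz ?int_num1// floor1 intrD mulrDr mulr1; ring.
Qed.

Lemma fold_period_id L x : 0 < L -> 0 <= x < L -> fold_period L x = x.
Proof.
move=> L0 /andP[x0 xL]; rewrite /fold_period (_ : Num.floor _ = 0) ?mulr0 ?subr0//.
by apply: floor_def; rewrite divr_ge0 ?(ltW L0)//= ltr_pdivrMr// mul1r.
Qed.

Lemma measurable_fold_period L : 0 < L -> measurable_fun [set: R] (fold_period L).
Proof.
move=> L0; apply: measurable_funB => //; apply: measurable_funM => //.
apply: nondecreasing_measurable => // x y xy.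
by rewrite ler_int; apply: le_floor; rewrite ler_pM2r// invr_gt0.
Qed.

End Calculus.

(** * Periodic solutions of y' + a y = h *)

Section Resolvent.
Context {R : realType}.
Notation li := (@locally_integrable R [set: R]).
Notation wd := (@is_weak_derivative R).
Implicit Types (a x L M : R) (y h : R -> R).

Lemma resolvent_exists L a h : 0 < L -> a != 0 -> li h -> periodic h L ->
  exists2 y, periodic y L & wd y (fun x => h x - a * y x).
Proof.
move=> L0 a0 lh ph.
have leh : li (fun x => expR (a * x) * h x).
  by apply: liM_continuous => //; exact: continuous_expRM.
have [H wH H0] := wd_exists 0 0 leh.
have eaL : expR (a * L) - 1 != 0.
  rewrite subr_eq0 -expR0 (inj_eq (@expR_inj R)).
  by rewrite mulf_neq0// gt_eqF.
(* The only initial value compatible with [F L = expR (a * L) * F 0]; [a != 0] makes the denominator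
   nonzero. *)
pose y0 := H L / (expR (a * L) - 1).
pose F x := H x + y0.
have wF : wd F (fun x => expR (a * x) * h x).
  by have := wdD wH (wd_cst y0); under [X in wd _ X]eq_fun do rewrite addr0.
have FL x : F (x + L) = expR (a * L) * F x.
  have w1 := wd_shift L wF.
  have w2 := wdZ (expR (a * L)) wF.
  have e : (fun x => expR (a * L) * (expR (a * x) * h x)) =
           (fun x => expR (a * (x + L)) * h (x + L)).
    by apply/funext => t; rewrite ph mulrDr expRD; ring.
  rewrite e in w2; apply: (wd_unique w1 w2 (c := 0)).
  by rewrite /= add0r /F H0 /y0; field.
clearbody F; exists (fun x => F x * expR (- a * x)).
  move=> x; rewrite FL.
  have -> : - a * (x + L) = - a * x + - (a * L) by ring.
  by rewrite expRD expRN; field; rewrite gt_eqF// expR_gt0.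
have := wdM wF (is_derive1_expRM (- a)) (continuousZ_fun (continuous_expRM (c := - a))).
congr (wd _ _); apply/funext => x.
by rewrite mulrA -expRD mulNr addNr expR0 mul1r; ring.
Qed.

Let wd_exp a h y : wd y (fun x => h x - a * y x) ->
  wd (fun x => y x * expR (a * x)) (fun x => expR (a * x) * h x).
Proof.
move=> wy; have := wdM wy (is_derive1_expRM a) (continuousZ_fun (continuous_expRM (c := a))).
by congr (wd _ _); apply/funext => x; ring.
Qed.

(* [y x * expR (a * x)] is nondecreasing and gets multiplied by [expR (a * L)]
   over a period. *)
Lemma resolvent_ge0 L a h y : 0 < L -> periodic y L ->
  wd y (fun x => h x - a * y x) -> (forall x, 0 <= h x) -> forall x, 0 <= a * y x.
Proof.
move=> L0 py /wd_exp wy h0 x.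
have /(_ x (x + L)) := wd_homo wy (fun x => mulr_ge0 (expR_ge0 _) (h0 x)).
rewrite py mulrDr expRD lerDl (ltW L0) => /(_ isT) le.
have : 0 <= y x * (expR (a * L) - 1).
  rewrite -(pmulr_lge0 _ (expR_gt0 (a * x))); lra.
have [a0|a0|a0] := ltgtP a 0; last by rewrite a0 !mul0r lexx.
- rewrite nmulr_lge0 ?subr_lt0 ?expR_lt1 ?pmulr_llt0// => y0.
  by rewrite nmulr_rge0.
- rewrite pmulr_lge0 ?subr_gt0 ?expR_gt1 ?mulr_gt0// => y0.
  by rewrite pmulr_rge0.
Qed.

(** The function [y x * expR (a * x)] is nondecreasing. If [y x0 = 0], it vanishes on a whole
    period, although it increases strictly near [x0], where [h > 0]. Once [y x0 != 0], monotonicity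
    carries the sign forward from [x0] if [a > 0] and backward if [a < 0]; a shift by whole periods
    reaches every [x]. *)
Lemma resolvent_gt0 L a h y : 0 < L -> a != 0 -> periodic y L -> continuous h ->
  wd y (fun x => h x - a * y x) -> (forall x, 0 <= h x) -> (exists x, 0 < h x) ->
  forall x, 0 < a * y x.
Proof.
move=> L0 a0 py ch wy h0 [x0 hx0].
have wye := wd_exp wy.
have ge := wd_homo wye (fun x => mulr_ge0 (expR_ge0 _) (h0 x)).
have pos := resolvent_ge0 L0 py wy h0.
have y0 : y x0 != 0.
  apply/eqP => y0.
  have cst x : x0 <= x <= x0 + L -> y x * expR (a * x) = 0.
    move=> /andP[x1 x2]; apply/eqP; rewrite eq_le; apply/andP; split.
      by have := ge _ _ x2; rewrite py y0 mul0r.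
    by have := ge _ _ x1; rewrite y0 mul0r.
  have ceh : continuous (fun x => expR (a * x) * h x).
    by apply: continuousM_fun => //; exact: continuous_expRM.
  have : 0 < expR (a * x0) * h x0 by rewrite mulr_gt0// expR_gt0.
  set m := expR (a * x0) * h x0 => m0.
  have m20 : 0 < m / 2 by lra.
  have [d d0 hd] := (continuous_distP _ _).1 (ceh x0) _ m20.
  pose e := Num.min (d / 2) L.
  have e0 : 0 < e by rewrite /e lt_min; apply/andP; split => //; lra.
  have eL : e <= L by rewrite /e ge_min lexx orbT.
  have ed : e < d by rewrite /e gt_min; apply/orP; left; lra.
  have := wye.2 x0 (x0 + e); rewrite lerDl (ltW e0) => /(_ isT).
  rewrite !cst ?lexx ?subrr; [|by apply/andP; split; lra..].
  have /int_le : forall x, x0 <= x <= x0 + e -> m / 2 <= expR (a * x) * h x.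
    move=> x /andP[x1 x2].
    have /hd : `|x - x0| < d by rewrite ger0_norm ?subr_ge0//; lra.
    by rewrite -/m ltr_norml => /andP[? _]; lra.
  move=> /(_ (li_cst _) wye.1); rewrite int_cst; last by lra.
  move=> le e1; have : m / 2 * (x0 + e - x0) <= 0 by rewrite e1.
  by rewrite addrAC subrr add0r pmulr_rle0//; lra.
move=> x; have [n xn] : exists n : nat, `|x - x0| <= L *+ n.
  exists (Num.truncn (`|x - x0| / L)).+1.
  by rewrite -mulr_natr mulrC -ler_pdivrMr// ltW// truncnS_gt.
move: xn; rewrite ler_norml => /andP[xn1 xn2].
have := pos x0; rewrite le_eqVlt eq_sym mulf_eq0 (negbTE a0) (negbTE y0)/=.
have [a_lt0|a_gt0|a_eq0] := ltgtP a 0; last by rewrite a_eq0 eqxx in a0.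
- rewrite !nmulr_rgt0// => yx0.
  have := periodicn py n (x - L *+ n); rewrite subrK => ->.
  have /ge : x - L *+ n <= x0 by lra.
  move=> le; rewrite -(pmulr_llt0 _ (expR_gt0 (a * (x - L *+ n)))).
  by apply: le_lt_trans le _; rewrite pmulr_llt0// expR_gt0.
- rewrite !pmulr_rgt0// => yx0.
  rewrite -(periodicn py n x).
  have /ge : x0 <= x + L *+ n by lra.
  move=> le; rewrite -(pmulr_lgt0 _ (expR_gt0 (a * (x + L *+ n)))).
  by apply: lt_le_trans le; rewrite pmulr_lgt0// expR_gt0.
Qed.

(** Comparison with a constant solution: [M / a + y] and [M / a - y] solve the same equation with
    the nonnegative sources [M + h] and [M - h]. *)
Lemma resolvent_bound L a h y M : 0 < L -> a != 0 -> periodic y L ->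
  wd y (fun x => h x - a * y x) -> (forall x, `|h x| <= M) ->
  forall x, `|y x| <= M / `|a|.
Proof.
move=> L0 a0 py wy hM x.
have key (s : R) : (forall x, 0 <= M + s * h x) -> 0 <= M + s * (a * y x).
  move=> h0.
  have w : wd (fun x => M / a + s * y x)
              (fun x => M + s * h x - a * (M / a + s * y x)).
    have := wdD (wd_cst (M / a)) (wdZ s wy).
    by congr (wd _ _); apply/funext => t; field.
  have p : periodic (fun x => M / a + s * y x) L by move=> t; rewrite py.
  have := resolvent_ge0 L0 p w h0 x.
  by rewrite (_ : a * (M / a + s * y x) = M + s * (a * y x))//; field.
rewrite ler_pdivlMr ?normr_gt0// -normrM ler_norml mulrC; apply/andP; split.
  have : 0 <= M + 1 * (a * y x).
    by apply: key => t; have := hM t; rewrite ler_norml => /andP[]; lra.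
  by lra.
have : 0 <= M + (- 1) * (a * y x).
  by apply: key => t; have := hM t; rewrite ler_norml => /andP[]; lra.
by lra.
Qed.

Lemma wd_lipschitz g h M x z : wd g h -> (forall t, `|h t| <= M) ->
  `|g x - g z| <= M * `|x - z|.
Proof.
move=> wg hM; have lh := wg.1; wlog xz : x z / x <= z.
  move=> W; have [/W//|/ltW/W] := leP x z.
  by rewrite distrC (distrC z).
rewrite distrC (distrC x) wg.2// (ger0_norm (x := z - x)) ?subr_ge0//.
apply: le_trans (int_norm _ _ lh) _.
rewrite -int_cst//; apply: int_le => //; [exact: li_norm|exact: li_cst].
Qed.

End Resolvent.

Section PeriodicExtrema.
Context {R : realType}.
Implicit Types (L : R) (g : R -> R).

Lemma periodic_max L g : 0 < L -> continuous g -> periodic g L ->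
  exists2 c, 0 <= c <= L & forall x, g x <= g c.
Proof.
move=> L0 cg pg.
have [|c cL gc] := @EVT_max R g 0 L (ltW L0); first exact: continuous_subspaceT.
exists c; first by move: cL; rewrite in_itv.
move=> x; rewrite -(periodic_fold x pg); apply: gc.
by have /andP[h1 h2] := fold_period_itv x L0; rewrite in_itv/= h1 ltW.
Qed.

Lemma periodic_gt0_min L g : 0 < L -> continuous g -> periodic g L ->
  (forall x, 0 < g x) -> exists2 e, 0 < e & forall x, e <= g x.
Proof.
move=> L0 cg pg g0.
have [|c cL gc] := @EVT_min R g 0 L (ltW L0); first exact: continuous_subspaceT.
exists (g c) => // x; rewrite -(periodic_fold x pg); apply: gc.
by have /andP[h1 h2] := fold_period_itv x L0; rewrite in_itv/= h1 ltW.
Qed.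

End PeriodicExtrema.

(** * The inverse of the shifted second-order operator *)

Section Green.
Context {R : realType}.
Notation li := (@locally_integrable R [set: R]).
Notation wd := (@is_weak_derivative R).
Variables (L l p : R).
Hypotheses (L0 : 0 < L) (l0 : 0 < l) (lp : l < p).
Implicit Types (h z : R -> R).

(* The equation - z'' - 2 l z' + (p ^ 2 - l ^ 2) z = h, factored into
   y' + (p + l) y = h and - z' + (p - l) z = y. *)
Definition green h z := exists y, [/\ periodic y L,
  wd y (fun x => h x - (p + l) * y x), periodic z L &
  wd z (fun x => - y x - (l - p) * z x)].

Let pl_gt0 : 0 < p + l. Proof. by move: l0 lp; lra. Qed.
Let lp_lt0 : l - p < 0. Proof. by move: l0 lp; lra. Qed.
Let pl_neq0 : p + l != 0. Proof. by rewrite gt_eqF. Qed.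
Let lp_neq0 : l - p != 0. Proof. by rewrite lt_eqF. Qed.
Let pp_gt0 : 0 < p ^+ 2 - l ^+ 2. Proof. by rewrite subr_sqr mulr_gt0//; move: l0 lp; lra. Qed.

Lemma green_exists h : li h -> periodic h L -> exists z, green h z.
Proof.
move=> lh ph; have [y py wy] := resolvent_exists L0 pl_neq0 lh ph.
have cy := wd_continuous wy.
have [||z pz wz] := @resolvent_exists R L (l - p) (fun x => - y x) L0 lp_neq0.
- exact/liN/li_continuous.
- by move=> x; rewrite py.
by exists z, y.
Qed.

Lemma green_lin h1 z1 h2 z2 c : green h1 z1 -> green h2 z2 ->
  green (fun x => h1 x + c * h2 x) (fun x => z1 x + c * z2 x).
Proof.
move=> [y1 [py1 wy1 pz1 wz1]] [y2 [py2 wy2 pz2 wz2]].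
exists (fun x => y1 x + c * y2 x); split.
- by move=> x; rewrite py1 py2.
- have := wdD wy1 (wdZ c wy2); congr (wd _ _); apply/funext => x; ring.
- by move=> x; rewrite pz1 pz2.
- have := wdD wz1 (wdZ c wz2); congr (wd _ _); apply/funext => x; ring.
Qed.

Lemma green_cst c : green (fun=> c) (fun=> c / (p ^+ 2 - l ^+ 2)).
Proof.
exists (fun=> c / (p + l)); split => //.
- have := wd_cst (c / (p + l)); congr (wd _ _); apply/funext => x; field.
  exact: pl_neq0.
- have := wd_cst (c / (p ^+ 2 - l ^+ 2)); congr (wd _ _); apply/funext => x; field.
  by rewrite pl_neq0 gt_eqF.
Qed.

Lemma green_periodic h z : green h z -> periodic z L.
Proof. by move=> [y []]. Qed.

Lemma green_continuous h z : green h z -> continuous z.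
Proof. by move=> [y [_ _ _ /wd_continuous]]. Qed.

Lemma green_ge0 h z : green h z -> (forall x, 0 <= h x) -> forall x, 0 <= z x.
Proof.
move=> [y [py wy pz wz]] h0 x.
have y0 t : 0 <= y t by have := resolvent_ge0 L0 py wy h0 t; rewrite pmulr_rge0.
(* The change of sign brings the second factor into the form of [resolvent_ge0], with source [y] and
   negative coefficient [l - p]. *)
pose z' t := - z t.
have wz' : wd z' (fun x => y x - (l - p) * z' x).
  by have := wdZ (- 1) wz; congr (wd _ _); apply/funext => t; rewrite /z'; ring.
have pz' : periodic z' L by move=> t; rewrite /z' pz.
by have := resolvent_ge0 L0 pz' wz' y0 x; rewrite /z' mulrN -mulNr pmulr_rge0// oppr_gt0.
Qed.

Lemma green_gt0 h z : green h z -> continuous h -> (forall x, 0 <= h x) ->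
  (exists x, 0 < h x) -> forall x, 0 < z x.
Proof.
move=> [y [py wy pz wz]] ch h0 hx x.
have y0 t : 0 < y t.
  by have := resolvent_gt0 L0 pl_neq0 py ch wy h0 hx t; rewrite pmulr_rgt0.
have cy := wd_continuous wy.
pose z' t := - z t.
have wz' : wd z' (fun x => y x - (l - p) * z' x).
  by have := wdZ (- 1) wz; congr (wd _ _); apply/funext => t; rewrite /z'; ring.
have pz' : periodic z' L by move=> t; rewrite /z' pz.
have yx : exists x, 0 < y x by exists 0.
have := resolvent_gt0 L0 lp_neq0 pz' cy wz' (fun t => ltW (y0 t)) yx x.
by rewrite /z' mulrN -mulNr pmulr_rgt0// oppr_gt0.
Qed.

Lemma green_le h1 z1 h2 z2 : green h1 z1 -> green h2 z2 ->
  (forall x, h1 x <= h2 x) -> forall x, z1 x <= z2 x.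
Proof.
move=> g1 g2 h12 x; have := green_ge0 (green_lin (- 1) g2 g1) _ x.
move=> H; have : 0 <= z2 x + -1 * z1 x by apply: H => t; have := h12 t; lra.
lra.
Qed.

Lemma green_bound h z M : green h z -> (forall x, `|h x| <= M) ->
  forall x, `|z x| <= M / (p ^+ 2 - l ^+ 2).
Proof.
move=> g hM x; rewrite ler_norml -mulNr; apply/andP; split.
  apply: (green_le (green_cst (- M)) g) => t.
  by have := hM t; rewrite ler_norml => /andP[].
apply: (green_le g (green_cst M)) => t.
by have := hM t; rewrite ler_norml => /andP[].
Qed.

(** In z' = - y + (p - l) z both terms are at most [M / (p + l)]. This is the equicontinuity that
    makes the Green operator compact. *)
Lemma green_lipschitz h z M : green h z -> (forall x, `|h x| <= M) ->
  forall x t, `|z x - z t| <= 2 * M / (p + l) * `|x - t|.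
Proof.
move=> g hM; have zM := green_bound g hM.
have [y [py wy pz wz]] := g.
have yM := resolvent_bound L0 pl_neq0 py wy hM.
move=> x t; apply: wd_lipschitz wz _ => s.
apply: le_trans (ler_normB _ _) _; rewrite normrN normrM.
rewrite gtr0_norm in yM => //.
rewrite (ltr0_norm lp_lt0).
have h1 := yM s.
have h2 : - (l - p) * `|z s| <= - (l - p) * (M / (p ^+ 2 - l ^+ 2)).
  by rewrite ler_wpM2l// oppr_ge0 ltW.
apply: le_trans (lerD h1 h2) _.
rewrite le_eqVlt; apply/orP; left; apply/eqP; field.
by rewrite pl_neq0 gt_eqF.
Qed.

(** The shift [p ^ 2] cancels from both sides, so [k] is minus the eigenvalue. The second derivative
    comes from differentiating the first-order equation for [z]. *)
Lemma green_eigensolution (b z : R -> R) k : 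
  green (fun x => (b x + p ^+ 2 - k) * z x) z -> is_eigensolution l b (- k) z.
Proof.
move=> [y [py wy pz wz]].
have cy := wd_continuous wy; have cz := wd_continuous wz.
have cdz : continuous (fun x => - y x - (l - p) * z x).
  apply: continuousB_fun; last exact: continuousZ_fun.
  by move=> x; apply: cvgN; exact: cy.
have dz x := wd_derive wz (cdz x).
have dzE : derive1 z = fun x => - y x - (l - p) * z x.
  by apply/funext => x; rewrite derive1E; have [_ ->] := dz x.
split; first by move=> x; have [] := dz x.
exists (fun x => - ((b x + p ^+ 2 - k) * z x - (p + l) * y x)
    - (l - p) * (- y x - (l - p) * z x)).
  rewrite dzE; have := wdB (wdZ (- 1) wy) (wdZ (l - p) wz).
  by congr (wd _ _); apply/funext => x; ring.
by apply: aeW => x; rewrite dzE; ring.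
Qed.

End Green.

(** * A positive eigenfunction from subsolutions *)

Section EigenvalueExistence.
Context {R : realType}.
Notation li := (@locally_integrable R [set: R]).

(* The positive operator [h |-> green h] with a fixed shift [p] turns the
   eigenvalue problem into a fixed point problem [z = green ((b + p ^ 2 - k) z)];
   the eigenvalue is the largest [k] admitting a subsolution. *)
Definition subsolvable (L l p : R) (b : R -> R) : set R :=
  [set k | k <= p ^+ 2 - 1 /\ exists psi z : R -> R, [/\ continuous psi, periodic psi L,
    forall x, 0 <= psi x <= 1, exists x, psi x = 1 &
    green L l p (fun x => (b x + p ^+ 2 - k) * psi x) z /\
    forall x, psi x <= z x]].

Section FixedData.
Variables (L l p M : R) (b : R -> R).
Hypotheses (L0 : 0 < L) (l0 : 0 < l) (lp : l < p) (pM : p ^+ 2 = M + l ^+ 2 + 2).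
Hypotheses (mb : measurable_fun [set: R] b) (pb : periodic b L)
  (bM : forall x, 0 <= b x <= M).

Implicit Types (k x : R) (psi z : R -> R).

Let M0 : 0 <= M.
Proof. by have /andP[h1 h2] := bM 0; exact: le_trans h1 h2. Qed.

Let q k x := b x + p ^+ 2 - k.

Let li_q k psi : continuous psi -> li (fun x => q k x * psi x).
Proof.
move=> cpsi; under eq_fun do rewrite mulrC; apply: liM_continuous => //.
apply: liB; last exact: li_cst.
apply: liD; last exact: li_cst.
apply: (li_bounded (M := M)) => // x; have /andP[b0 bx] := bM x.
by rewrite ger0_norm.
Qed.

Let periodic_q k psi : periodic psi L -> periodic (fun x => q k x * psi x) L.
Proof. by move=> ppsi x; rewrite /q pb ppsi. Qed.

(** The cap on [k] in [subsolvable] serves this bound: a positive weight makes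
    [psi |-> green (q k psi)] order preserving. *)
Let q_ge1 k x : k <= p ^+ 2 - 1 -> 1 <= q k x.
Proof. by move=> kp; have /andP[b0 _] := bM x; rewrite /q; lra. Qed.

(** Division by the maximum of [psi] restores the normalisation to maximum 1, which keeps limits of
    subsolutions from degenerating to 0. *)
Lemma subsolvableP k psi z : k <= p ^+ 2 - 1 -> continuous psi -> periodic psi L ->
  (forall x, 0 <= psi x) -> (exists x, 0 < psi x) ->
  green L l p (fun x => q k x * psi x) z -> (forall x, psi x <= z x) ->
  subsolvable L l p b k.
Proof.
move=> kp cpsi ppsi psi0 [x0 psix0] gz psiz; split => //.
have [c _ cmax] := periodic_max L0 cpsi ppsi.
have c0 : 0 < psi c by apply: lt_le_trans (cmax x0).
exists (fun x => (psi c)^-1 * psi x), (fun x => (psi c)^-1 * z x); split.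
- exact: continuousZ_fun.
- by move=> x; rewrite ppsi.
- move=> x; rewrite mulr_ge0 ?invr_ge0//=.
  by rewrite mulrC ler_pdivrMr// mul1r.
- by exists c; rewrite mulVf// gt_eqF.
- split; last by move=> x; rewrite ler_pM2l// invr_gt0.
  have := green_lin (psi c)^-1 (green_cst L l0 lp 0) gz.
  congr (green _ _ _ _ _); apply/funext => x; last by rewrite mul0r add0r.
  by rewrite add0r /q; ring.
Qed.

(** The constant 1 is a subsolution: at [k = l ^ 2] the weight is at least [p ^ 2 - l ^ 2], and the
    Green image of that constant is 1. *)
Lemma subsolvable_sqr : subsolvable L l p b (l ^+ 2).
Proof.
have c1 : continuous (fun _ : R => 1 : R) by exact: continuous_cst_fun.
have p1 : periodic (fun _ : R => 1 : R) L by [].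
have [z gz] := green_exists L0 l0 lp (li_q (l ^+ 2) c1) (periodic_q (l ^+ 2) p1).
apply: (subsolvableP _ c1 p1 _ _ gz) => [|||x].
- by rewrite pM; move: M0; lra.
- by [].
- by exists 0.
- have := green_le L0 l0 lp (green_cst L l0 lp (p ^+ 2 - l ^+ 2)) gz _ x.
  rewrite divff; last by rewrite gt_eqF// pM; move: M0; lra.
  by apply=> t; have /andP[b0 _] := bM t; rewrite /q; lra.
Qed.

(** Where [psi = 1], the sup bound on the Green image gives [k <= M + l ^ 2], which is [p ^ 2 - 2]
    by the choice of [p]. The gap of 1 to the cap in [subsolvable] is the room in which [k0] is
    raised later. *)
Lemma subsolvable_le k : subsolvable L l p b k -> k <= p ^+ 2 - 2.
Proof.
move=> [kp [psi [z [cpsi ppsi psi01 [x0 psix0] [gz psiz]]]]].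
have pl : 0 < p ^+ 2 - l ^+ 2 by rewrite pM; move: M0; lra.
have := green_bound L0 l0 lp gz (M := M + p ^+ 2 - k) _ x0.
move=> zb; have {zb} : `|z x0| <= (M + p ^+ 2 - k) / (p ^+ 2 - l ^+ 2).
  apply: zb => x; have q1 := q_ge1 x kp; have /andP[y0 y1] := psi01 x.
  have /andP[b0 b1] := bM x.
  rewrite ger0_norm; last by rewrite mulr_ge0// (le_trans _ q1).
  have : q k x * psi x <= q k x by rewrite ler_piMr// (le_trans _ q1).
  by rewrite /q; lra.
rewrite ler_pdivlMr//; have := psiz x0; rewrite psix0 => z1.
have : 1 <= `|z x0| by rewrite (le_trans z1)// ler_norm.
move=> n1 le; have : p ^+ 2 - l ^+ 2 <= M + p ^+ 2 - k.
  by apply: le_trans le; rewrite ler_peMl// ltW.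
by rewrite pM; lra.
Qed.

Let k0 := sup (subsolvable L l p b).

Let has_sup_subsolvable : has_sup (subsolvable L l p b).
Proof.
split; first by exists (l ^+ 2); exact: subsolvable_sqr.
by exists (p ^+ 2 - 2) => k; exact: subsolvable_le.
Qed.

Let k0_le : k0 <= p ^+ 2 - 2.
Proof.
by apply: ge_sup; [case: has_sup_subsolvable|move=> k; exact: subsolvable_le].
Qed.

(** Almost optimal [psi] have no common modulus of continuity, but their Green images [z] are
    equi-Lipschitz and are again subsolutions, since [psi <= z]. So the limit [chi] is taken of the
    images; as each [psi] reaches 1, [chi] is at least 1/2 somewhere. *)
Lemma subsolvable_sup_attained : exists chi z : R -> R, [/\ continuous chi, periodic chi L,
  forall x, 0 <= chi x, exists x, 0 < chi x &
  green L l p (fun x => q k0 x * chi x) z /\ forall x, chi x <= z x].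
Proof.
have pl : 0 < p ^+ 2 - l ^+ 2 by rewrite pM; move: M0; lra.
have pl2 : 0 < p + l by move: l0 lp; lra.
pose ok n (v : R * (R -> R) * (R -> R)) := let: (k, psi, z) := v in
  [/\ k0 - (n.+1%:R)^-1 < k, k <= k0 &
  [/\ continuous psi, periodic psi L,
    forall x, 0 <= psi x <= 1, exists x, psi x = 1 &
    green L l p (fun x => q k x * psi x) z /\
    forall x, psi x <= z x]].
have /choice[v vP] : forall n : nat, exists v, ok n v.
  move=> n; have [|k Sk kk] := sup_adherent _ has_sup_subsolvable (eps := (n.+1%:R)^-1).
    by rewrite invr_gt0.
  have [kp [psi [z H]]] := Sk; exists (k, psi, z); split => //.
  by apply: ub_le_sup => //; case: has_sup_subsolvable.
pose Q := M + p ^+ 2 - k0 + 1.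
have qQ n x : 1 <= q (v n).1.1 x <= Q.
  have := vP n; case: (v n) => -[k psi] z /= [h1 h2 _].
  have h3 : (n.+1%:R)^-1 <= 1 :> R by rewrite invf_le1 ?ler1n.
  have /andP[b0 b1] := bM x; rewrite /q /Q.
  move: k0_le h1 h2 h3 b0 b1; set r := _^-1; clearbody k0 r.
  by move=> ? ? ? ? ? ?; apply/andP; split; lra.
have Q0 : 1 <= Q by have /andP[h1 h2] := qQ 0%N 0; exact: le_trans h1 h2.
have hQ n x : `|q (v n).1.1 x * (v n).1.2 x| <= Q.
  have /andP[h1 h2] := qQ n x; have := vP n; case: (v n) h1 h2 => -[k psi] z /= h1 h2.
  move=> [_ _ [_ _ /(_ x)/andP[y0 y1] _ _]].
  have q0 : 0 <= q k x by exact: le_trans h1.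
  by rewrite ger0_norm ?mulr_ge0// (le_trans _ h2)// ler_piMr.
have gz n : green L l p (fun x => q (v n).1.1 x * (v n).1.2 x) (v n).2.
  by have := vP n; case: (v n) => -[k psi] z /= [_ _ [_ _ _ _ []]].
pose C := Q / (p ^+ 2 - l ^+ 2).
have C0 : 0 <= C by rewrite divr_ge0// ltW// (lt_le_trans ltr01).
have zC n x : `|(v n).2 x| <= C by apply: (green_bound L0 l0 lp (gz n)).
pose C' := 2 * Q / (p + l).
have C'0 : 0 < C'.
  by rewrite /C' divr_gt0// mulr_gt0// (lt_le_trans ltr01).
have zL n x t : `|(v n).2 x - (v n).2 t| <= C' * `|x - t|.
  by apply: (green_lipschitz L0 l0 lp (gz n)).
have [|g gP] := @ascoli_cluster R L C (fun n => (v n).2) L0 (fun n x _ => zC n x).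
  move=> e e0; exists (e / C'); first exact: divr_gt0.
  move=> n x t _ _ xt; apply: le_trans (zL n x t) _.
  by rewrite mulrC -ler_pdivlMr// ltW.
pose chi x := g (fold_period L x).
have pchi : periodic chi L by move=> x; rewrite /chi fold_period_periodic.
have chiP e N : 0 < e -> exists2 n, (N <= n)%N & forall x, `|(v n).2 x - chi x| <= e.
  move=> e0; have [n Nn ng] := gP e N e0; exists n => // x.
  rewrite -(periodic_fold x (green_periodic (gz n))); apply: ng.
  by have /andP[-> /ltW->] := fold_period_itv x L0.
have chiL x t : `|chi x - chi t| <= C' * `|x - t|.
  apply/ler_addgt0Pl => e e0; have [|n _ nP] := chiP (e / 2) 0%N; first lra.
  have := nP x; have := nP t; have := zL n x t.
  rewrite !ler_norml => /andP[? ?] /andP[? ?] /andP[? ?].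
  by apply/andP; split; lra.
have cchi : continuous chi.
  move=> x; apply/continuous_distP => e e0.
  exists (e / C'); first exact: divr_gt0.
  move=> t xt; apply: le_lt_trans (chiL _ _) _.
  by rewrite mulrC -ltr_pdivlMr.
have [z gzchi] := green_exists L0 l0 lp (li_q k0 cchi) (periodic_q k0 pchi).
have psi_le n x : 0 <= (v n).1.2 x <= (v n).2 x.
  have := vP n; case: (v n) => -[k psi] zn /= [_ _ [_ _ /(_ x)/andP[-> _] _ [_ zx]]].
  exact: zx.
have chi0 x : 0 <= chi x.
  apply/ler_addgt0Pl => e e0; have [n _ nP] := chiP e 0%N e0.
  have := nP x; have /andP[? ?] := psi_le n x.
  by rewrite ler_norml => /andP[? ?]; lra.
have chiC x : chi x <= C.
  apply/ler_addgt0Pl => e e0; have [n _ nP] := chiP e 0%N e0.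
  have := nP x; have := zC n x; rewrite !ler_norml => /andP[? ?] /andP[? ?].
  lra.
exists chi, z; split => //.
  have [|n _ nP] := chiP (1 / 2) 0%N; first lra.
  have [x psix] : exists x, (v n).1.2 x = 1.
    by have := vP n; case: (v n) => -[k psi] zn /= [_ _ [_ _ _ ? _]].
  exists x; have := nP x; have /andP[? ?] := psi_le n x.
  by rewrite ler_norml => /andP[? ?]; lra.
split => // x.
(* The 1 accounts for the uniform distance [e] from [(v n).2] to [chi]. The sources differ by
   [q * ((v n).2 - chi) + (k0 - k) * chi], at most [e * (Q + C)], and [green_bound] divides this by
   [p ^ 2 - l ^ 2]. *)
pose K := 1 + (Q + C) / (p ^+ 2 - l ^+ 2).
have QC : 0 <= Q + C by rewrite addr_ge0// (le_trans ler01).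
have K0 : 0 < K by rewrite /K ltr_pwDl// divr_ge0// ltW.
suff key e : 0 < e -> chi x <= z x + e * K.
  apply/ler_addgt0Pl => e e0; have := key (e / K) (divr_gt0 e0 K0).
  by rewrite divfK ?gt_eqF// addrC.
move=> e0.
have [n Nn nP] := chiP e (Num.truncn e^-1) e0.
have kn : k0 - (v n).1.1 <= e.
  have : (n.+1%:R)^-1 <= e.
    rewrite -[e]invrK lef_pV2 ?posrE ?invr_gt0 ?ltr0n//.
    by rewrite ltW// (lt_le_trans (truncnS_gt _))// ler_nat ltnS.
  have := vP n; case: (v n) => -[k psi] zn /= [h1 _ _] h2.
  by move: (n.+1%:R^-1) h1 h2 => r; lra.
have kn0 : 0 <= k0 - (v n).1.1.
  by have := vP n; case: (v n) => -[k psi] zn /= [_ h1 _]; rewrite subr_ge0.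
have czn := green_continuous (gz n).
have pzn := green_periodic (gz n).
have [zn' gzn'] := green_exists L0 l0 lp (li_q (v n).1.1 czn) (periodic_q (v n).1.1 pzn).
have z1 : (v n).2 x <= zn' x.
  apply: (green_le L0 l0 lp (gz n) gzn') => t.
  have /andP[? ?] := psi_le n t; have /andP[q1 _] := qQ n t.
  by rewrite ler_wpM2l// (le_trans ler01).
have H := green_bound L0 l0 lp (green_lin (- 1) gzn' gzchi) (M := e * (Q + C)).
pose D := (Q + C) / (p ^+ 2 - l ^+ 2).
have : `|zn' x + -1 * z x| <= e * D.
  rewrite /D mulrA; apply: H => t.
  have -> : q (v n).1.1 t * (v n).2 t + -1 * (q k0 t * chi t) =
    q (v n).1.1 t * ((v n).2 t - chi t) + (k0 - (v n).1.1) * chi t.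
    by rewrite /q; ring.
  have /andP[q1 q2] := qQ n t.
  apply: le_trans (ler_normD _ _) _; rewrite !normrM mulrDr lerD//.
    rewrite mulrC ler_pM//; last by rewrite ger0_norm// (le_trans ler01).
  by rewrite ler_pM// ?ger0_norm.
rewrite /K -/D ler_norml => /andP[_ h]; have := nP x.
by rewrite ler_norml => /andP[h' _]; lra.
Qed.

(** If [chi] is a fixed point, it is the eigenfunction. Otherwise strong positivity applied to
    [z - chi] makes the image [w] of [z] exceed [z] by a uniform [eps]; raising [k0] by [t] lowers
    that image by only [t * s <= eps], so [z] is a subsolution beyond the supremum, a
    contradiction. *)
Lemma principal_eigenvalue_fixed : is_principal_eigenvalue L l b (- k0).
Proof.
have pl : 0 < p ^+ 2 - l ^+ 2 by rewrite pM; move: M0; lra.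
have k0p : k0 <= p ^+ 2 - 1 by move: k0_le; lra.
have [chi [z [cchi pchi chi0 chix [gz chiz]]]] := subsolvable_sup_attained.
have cz := green_continuous gz; have pz := green_periodic gz.
have z0 x : 0 < z x.
  have [w gw] := green_exists L0 l0 lp (li_continuous cchi) pchi.
  apply: lt_le_trans (green_gt0 L0 l0 lp gw cchi chi0 chix x) _.
  apply: (green_le L0 l0 lp gw gz) => t.
  by rewrite ler_peMl// q_ge1.
have [e|/existsNP[x0 /eqP ne]] := pselect (forall x, chi x = z x).
  exists z; split => //; apply: (green_eigensolution (p := p) (L := L)).
  by move: gz; rewrite (_ : chi = z) //; exact/funext.
exfalso.
have [w gw] := green_exists L0 l0 lp (li_q k0 cz) (periodic_q k0 pz).
have cd : continuous (fun x => z x - chi x) by exact: continuousB_fun.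
have pd : periodic (fun x => z x - chi x) L by move=> x; rewrite pz pchi.
have [d gd] := green_exists L0 l0 lp (li_continuous cd) pd.
have d0 : forall x, 0 < d x.
  apply: (green_gt0 L0 l0 lp gd cd) => [x|]; first by rewrite subr_ge0.
  by exists x0; rewrite subr_gt0 lt_neqAle ne chiz.
have [eps eps0 deps] := periodic_gt0_min L0 (green_continuous gd) (green_periodic gd) d0.
have wz x : z x + eps <= w x.
  have gwz := green_lin (- 1) gw gz.
  have := green_le L0 l0 lp gd gwz _ x => H.
  have : d x <= w x + -1 * z x.
    apply: H => t; have := q_ge1 t k0p; have := chiz t => ? q1.
    have -> : q k0 t * z t + -1 * (q k0 t * chi t) = q k0 t * (z t - chi t) by ring.
    by rewrite ler_peMl// subr_ge0.
  by have := deps x; lra.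
have [s gs] := green_exists L0 l0 lp (li_continuous cz) pz.
have [c _ smax] := periodic_max L0 (green_continuous gs) (green_periodic gs).
have s0 : 0 < s c by apply: (green_gt0 L0 l0 lp gs cz) => [x|]; [exact: ltW|exists 0].
pose t := Num.min 1 (eps / s c).
have t0 : 0 < t by rewrite lt_min ltr01 divr_gt0.
have t1 : t <= 1 by rewrite ge_min lexx.
have ts x : t * s x <= eps.
  apply: (@le_trans _ _ (t * s c)); first by rewrite ler_wpM2l// ltW.
  by rewrite -ler_pdivlMr// ge_min lexx orbT.
have : subsolvable L l p b (k0 + t).
  apply: (subsolvableP (z := fun x => w x + - t * s x) _ cz pz) => [||||x].
  - by move: k0_le; lra.
  - by move=> x; exact: ltW.
  - by exists 0.
  - have := green_lin (- t) gw gs; congr (green _ _ _ _ _).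
    by apply/funext => x; rewrite /q; ring.
  - by have := wz x; have := ts x; lra.
move=> /(ub_le_sup (proj2 has_sup_subsolvable)).
by rewrite -/k0 gerDl leNgt t0.
Qed.

End FixedData.

Lemma principal_eigenvalue_exists (L l M : R) (b : R -> R) :
  0 < L -> 0 < l -> measurable_fun [set: R] b -> periodic b L ->
  (forall x, 0 <= b x <= M) -> exists k, is_principal_eigenvalue L l b k.
Proof.
move=> L0 l0 mb pb bM.
have M0 : 0 <= M by have /andP[h1 h2] := bM 0; exact: le_trans h1 h2.
pose p := Num.sqrt (M + l ^+ 2 + 2).
have p2 : p ^+ 2 = M + l ^+ 2 + 2.
  by rewrite sqr_sqrtr// addr_ge0// addr_ge0// sqr_ge0.
have lp : l < p.
  rewrite -(ltr_pXn2r (n := 2))// ?nnegrE ?sqrtr_ge0 ?ltW//.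
  by rewrite p2; lra.
by eexists; exact: (principal_eigenvalue_fixed L0 l0 lp p2 mb pb bM).
Qed.

End EigenvalueExistence.

(** * Variational formula for the eigenvalue and the speed *)

Section Variational.
Context {R : realType}.
Notation mu := (@lebesgue_measure R).
Notation li := (@locally_integrable R [set: R]).
Notation wd := (@is_weak_derivative R).
Implicit Types (L l k x : R) (b w dw psi f g : R -> R).

Lemma continuousV_fun f : continuous f -> (forall x, 0 < f x) ->
  continuous (fun x => (f x)^-1).
Proof. by move=> cf f0 x; apply: cvgV; [rewrite gt_eqF|exact: cf]. Qed.

Lemma continuous_div_fun f g : continuous f -> continuous g -> (forall x, 0 < g x) ->
  continuous (fun x => f x / g x).
Proof. by move=> cf cg g0; apply: continuousM_fun => //; exact: continuousV_fun. Qed.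

Lemma is_derive1V f x df : 0 < f x -> is_derive x (1 : R) f df ->
  is_derive x (1 : R) (fun y => (f y)^-1) (- df / f x ^+ 2).
Proof.
move=> f0 hf; have := @is_deriveV R f x df 1 (lt0r_neq0 f0) hf.
by move/is_derive_eq; apply; rewrite /GRing.scale/= mulNr mulNr mulrC.
Qed.

Lemma is_derive1_ln_comp f x df : 0 < f x -> is_derive x (1 : R) f df ->
  is_derive x (1 : R) (fun y => ln (f y)) (df / f x).
Proof.
move=> f0 hf; have := @is_derive1_comp R (@ln R) f x _ _ (is_derive1_ln f0) hf.
by move/is_derive_eq; apply; rewrite mulrC.
Qed.

Lemma int_gt0 f a c : continuous f -> (forall x, 0 < f x) -> a < c ->
  0 < \int[mu]_(t in `[a, c]) f t.
Proof.
move=> cf f0 ac.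
have [|d _ fd] := @EVT_min R f a c (ltW ac); first exact: continuous_subspaceT.
apply: (@lt_le_trans _ _ (\int[mu]_(t in `[a, c]) f d)).
  by rewrite int_cst ?(ltW ac)// mulr_gt0// subr_gt0.
apply: int_le; [exact: li_cst|exact: li_continuous|].
by move=> x xac; apply: fd; rewrite in_itv.
Qed.

Lemma derive_periodic L f df : periodic f L -> (forall x, is_derive x (1 : R) f (df x)) ->
  periodic df L.
Proof.
move=> pf hf x.
have h : is_derive x (1 : R) (fun y => y + L) 1.
  have := is_derive1D (is_derive_id x (1 : R)) (is_derive_cst L x (1 : R)).
  by rewrite addr0.
have h2 := @is_derive1_comp R f (fun y => y + L) x _ _ (hf (x + L)) h.
have e : f \o (fun y => y + L) = f by apply/funext => y; exact: pf.
rewrite e mulr1 in h2.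
by have [_ <-] := h2; have [_ <-] := hf x.
Qed.

Lemma int_dlog L f df : 0 < L -> periodic f L ->
  (forall x, is_derive x (1 : R) f (df x)) -> continuous df -> (forall x, 0 < f x) ->
  \int[mu]_(t in `[0, L]) (df t / f t) = 0.
Proof.
move=> L0 pf hf cdf f0.
have cf : continuous f by move=> x; exact: is_derive_continuous (hf x).
have := derive_wd (fun x => is_derive1_ln_comp (f0 x) (hf x)) (continuous_div_fun cdf cf f0).
by move=> [_ <-]; [rewrite -[in ln (f L)](add0r L) pf subrr|exact: ltW].
Qed.

Record test_function L w dw : Prop := TestFunction {
  test_derive : forall x, is_derive x (1 : R) w (dw x);
  test_continuous : continuous dw;
  test_periodic : periodic w L;
  test_gt0 : forall x, 0 < w x;
  test_mass : \int[mu]_(t in `[0, L]) w t = 1 }.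

(** The Dirichlet energy of the square root of [w], as (sqrt w)' = w' / (2 sqrt w). *)
Definition dissipation L w dw := \int[mu]_(t in `[0, L]) (dw t ^+ 2 / (4 * w t)).
(** For a test function, the harmonic mean of [w] over its arithmetic mean [L^-1]. This is A(w), and
    [action] is B(w, b). *)
Definition harmonic_ratio L w := L ^+ 2 / \int[mu]_(t in `[0, L]) (w t)^-1.
Definition action L b w dw := \int[mu]_(t in `[0, L]) (w t * b t) - dissipation L w dw.

Lemma test_fun_continuous L w dw : test_function L w dw -> continuous w.
Proof. by move=> tw x; exact: is_derive_continuous (test_derive tw x). Qed.

Lemma continuous_dissipation L w dw : test_function L w dw ->
  continuous (fun t => dw t ^+ 2 / (4 * w t)).
Proof.
move=> tw; have cw := test_fun_continuous tw; have cdw := test_continuous tw.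
apply: continuous_div_fun; last by move=> x; rewrite mulr_gt0// (test_gt0 tw).
  exact: continuousM_fun.
exact: continuousZ_fun.
Qed.

Lemma inv_test_int_gt0 L w dw : 0 < L -> test_function L w dw ->
  0 < \int[mu]_(t in `[0, L]) (w t)^-1.
Proof.
move=> L0 tw; apply: int_gt0 => //; last first.
  by move=> x; rewrite invr_gt0; exact: test_gt0 tw x.
by apply: continuousV_fun; [exact: test_fun_continuous tw|exact: test_gt0 tw].
Qed.

Section Eigenpair.
Variables (L l k : R) (b psi : R -> R).
Hypotheses (L0 : 0 < L) (lb : li b) (ppsi : periodic psi L)
  (psi0 : forall x, 0 < psi x) (eig : is_eigensolution l b k psi).

(** The logarithmic derivative of [expR (l * x) * psi x], a function whose equation has no drift
    term. *)
Let u x := derive1 psi x / psi x + l.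

Let dpsi x : is_derive x (1 : R) psi (derive1 psi x).
Proof. by apply: DeriveDef; [exact: eig.1|rewrite derive1E]. Qed.

Let cpsi : continuous psi.
Proof. by move=> x; exact: is_derive_continuous (dpsi x). Qed.

(** The equation holds only almost everywhere; exchanging the weak derivative for the expression it
    equals there makes it usable pointwise under integrals. *)
Let wdpsi1 : wd (derive1 psi)
  (fun x => - 2 * l * derive1 psi x - psi x * (b x + l ^+ 2 + k)).
Proof.
have [_ [psi2 w2 e]] := eig; have c1 := wd_continuous w2.
apply: (wd_ae _ w2).
  apply: liB; first by apply: li_continuous; exact: continuousZ_fun.
  apply: liM_continuous => //; apply: liD; last exact: li_cst.
  by apply: liD => //; exact: li_cst.
apply: filterS e; first exact: (ae_filter_ringOfSetsType mu).
by move=> x e; lra.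
Qed.

Let cdpsi : continuous (derive1 psi).
Proof. exact: wd_continuous wdpsi1. Qed.

Let cu : continuous u.
Proof.
apply: continuousD_fun; last exact: continuous_cst_fun.
exact: continuous_div_fun.
Qed.

Let int_u : \int[mu]_(t in `[0, L]) u t = l * L.
Proof.
rewrite intD//; last exact: li_cst.
  by rewrite (int_dlog L0 ppsi dpsi)// int_cst ?ltW// subr0 add0r.
by apply: li_continuous; exact: continuous_div_fun.
Qed.

(* Integrate the equation for [psi] against [w / psi]; this is the Riccati
   equation [u' + u ^ 2 + b = - k] tested against [w]. *)
Lemma riccati_identity w dw : test_function L w dw ->
  - k = action L b w dw
    + \int[mu]_(t in `[0, L]) ((dw t / 2 - u t * w t) ^+ 2 / w t).
Proof.
move=> tw; have cw := test_fun_continuous tw; have cdw := test_continuous tw.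
have w0 := test_gt0 tw; have pw := test_periodic tw.
have dG x := is_derive1M (test_derive tw x) (is_derive1V (psi0 x) (dpsi x)).
have cV := continuousV_fun cpsi psi0.
have cG : continuous (fun x => dw x / psi x + w x * (- derive1 psi x / psi x ^+ 2)).
  apply: continuousD_fun; first exact: continuous_div_fun.
  apply: continuousM_fun => //; apply: continuous_div_fun.
  - by move=> x; apply: cvgN; exact: cdpsi.
  - exact: continuousM_fun.
  - by move=> x; rewrite exprn_gt0.
have wG := wdM wdpsi1 dG cG.
have := wG.2 0 L (ltW L0).
have pd := derive_periodic ppsi dpsi.
rewrite -[L in derive1 psi L](add0r L) -[L in w L](add0r L) -[L in psi L](add0r L).
rewrite pd pw ppsi subrr.
pose h1 t := w t * b t; pose h2 t := dw t ^+ 2 / (4 * w t).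
pose h3 t := (dw t / 2 - u t * w t) ^+ 2 / w t.
rewrite (@eq_int _ _ (fun t => - (h1 t - h2 t + (h3 t + (k * w t + l * dw t))))); last first.
  move=> t _; rewrite /h1 /h2 /h3 /u; field.
  by rewrite !gt_eqF.
have l1 : li h1 by exact: liM_continuous.
have l2 : li h2 by apply: li_continuous; exact: continuous_dissipation tw.
have l3 : li h3.
  apply: li_continuous; apply: continuous_div_fun => //.
  have c : continuous (fun t => dw t / 2 - u t * w t).
    apply: continuousB_fun; last exact: continuousM_fun.
    by apply: continuousM_fun => //; exact: continuous_cst_fun.
  exact: continuousM_fun.
have lw : li (fun t => k * w t) by apply: liZ; exact: li_continuous.
have ldw : li (fun t => l * dw t) by apply: liZ; exact: li_continuous.
have -> : (fun t => - (h1 t - h2 t + (h3 t + (k * w t + l * dw t)))) =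
  (fun t => (-1) * (h1 t - h2 t + (h3 t + (k * w t + l * dw t)))).
  by apply/funext => t; rewrite mulN1r.
rewrite intZ; last by apply: liD; [exact: liB|apply: liD => //; exact: liD].
rewrite intD; [|exact: liB|by apply: liD => //; exact: liD].
rewrite intB// intD//; last exact: liD.
rewrite intD// !intZ; [|exact: li_continuous..].
rewrite (test_mass tw) -(derive_wd (test_derive tw) cdw).2 ?ltW//.
rewrite -[L in w L](add0r L) pw subrr mulr0 mulr1 addr0 /action /dissipation.
by rewrite -/h1 -/h2 -/h3; lra.
Qed.

(* Cauchy-Schwarz for [int g / w = - l L], where [g = w' / 2 - u w]. *)
Lemma eigenvalue_ge w dw : test_function L w dw ->
  l ^+ 2 * harmonic_ratio L w + action L b w dw <= - k.
Proof.
move=> tw; rewrite (riccati_identity tw) addrC lerD2l.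
have cw := test_fun_continuous tw; have cdw := test_continuous tw.
have w0 := test_gt0 tw; have pw := test_periodic tw.
pose T := \int[mu]_(t in `[0, L]) (w t)^-1.
have T0 : 0 < T by exact: inv_test_int_gt0 tw.
(* The minimizer in [C] of the integral of [(g + C) ^ 2 / w]. *)
pose C := l * L / T.
pose g t := dw t / 2 - u t * w t.
have cg : continuous g.
  apply: continuousB_fun; last exact: continuousM_fun.
  by apply: continuousM_fun => //; exact: continuous_cst_fun.
have lV : li (fun t => (w t)^-1) by apply: li_continuous; exact: continuousV_fun.
have lg : li (fun t => g t ^+ 2 / w t).
  by apply: li_continuous; apply: continuous_div_fun => //; exact: continuousM_fun.
have lgw : li (fun t => g t / w t).
  by apply: li_continuous; exact: continuous_div_fun.
have igw : \int[mu]_(t in `[0, L]) (g t / w t) = - (l * L).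
  rewrite (@eq_int _ _ (fun t => 2^-1 * (dw t / w t) - u t)); last first.
    by move=> t _; rewrite /g; field; rewrite gt_eqF.
  have ld : li (fun t => dw t / w t).
    by apply: li_continuous; exact: continuous_div_fun.
  rewrite intB; [|exact: liZ|exact: li_continuous].
  by rewrite intZ// (int_dlog L0 pw (test_derive tw))// int_u mulr0 sub0r.
have : 0 <= \int[mu]_(t in `[0, L]) ((g t + C) ^+ 2 / w t).
  by apply: int_ge0 => t _; rewrite divr_ge0 ?sqr_ge0// ltW.
rewrite (@eq_int _ _ (fun t =>
  g t ^+ 2 / w t + (2 * C * (g t / w t) + C ^+ 2 * (w t)^-1))); last first.
  by move=> t _; ring.
rewrite intD//; last by apply: liD; exact: liZ.
rewrite intD; [|exact: liZ..].
rewrite !intZ// igw -/T /harmonic_ratio -/T.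
have -> : l ^+ 2 * (L ^+ 2 / T) = 2 * C * (l * L) - C ^+ 2 * T.
  by rewrite /C; field; rewrite gt_eqF.
by rewrite /g; lra.
Qed.

(* The optimal [w] solves [w' = 2 u w - 2 C], which makes the Cauchy-Schwarz
   inequality of [eigenvalue_ge] an equality; with [phi = expR (l x) psi] its
   periodic solution is [phi ^ 2 (c1 - 2 int phi ^ -2)], up to normalisation. *)
Lemma eigenvalue_attained : 0 < l -> exists w dw, test_function L w dw /\
  - k = l ^+ 2 * harmonic_ratio L w + action L b w dw.
Proof.
move=> l0.
pose phi x := expR (l * x) * psi x.
have phi0 x : 0 < phi x by rewrite mulr_gt0// expR_gt0.
have dphi x : is_derive x (1 : R) phi (u x * phi x).
  have := is_derive1M (is_derive1_expRM l x) (dpsi x).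
  by move/is_derive_eq; apply; rewrite /u /phi; field; rewrite gt_eqF.
have cphi : continuous phi by move=> x; exact: is_derive_continuous (dphi x).
have phiL x : phi (x + L) = expR (l * L) * phi x.
  by rewrite /phi ppsi mulrDr expRD; ring.
pose f x := (phi x ^+ 2)^-1.
have phi20 x : 0 < phi x ^+ 2 by rewrite exprn_gt0.
have f0 x : 0 < f x by rewrite invr_gt0.
have cf : continuous f by apply: continuousV_fun => //; exact: continuousM_fun.
have [P wP P0] := wd_exists 0 0 (li_continuous cf).
pose E := expR (l * L).
have E1 : 1 < E by rewrite expR_gt1 mulr_gt0.
have E20 : 0 < E ^+ 2 by rewrite exprn_gt0// (lt_trans ltr01).
have E21 : 1 < E ^+ 2 by rewrite expr_gt1// ltW// (lt_trans ltr01).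
(* Forced by [z L = (E ^+ 2)^-1 * z 0], which offsets the factor [E ^+ 2] that [phi ^ 2] gains over
   a period. *)
pose c1 := 2 * P L * E ^+ 2 / (E ^+ 2 - 1).
pose z x := c1 - 2 * P x.
have wz : wd z (fun x => - 2 * f x).
  by have := wdB (wd_cst c1) (wdZ 2 wP); congr (wd _ _); apply/funext => x; ring.
have zL x : z (x + L) = (E ^+ 2)^-1 * z x.
  have w1 := wd_shift L wz; have w2 := wdZ (E ^+ 2)^-1 wz.
  have e : (fun x => - 2 * f (x + L)) = (fun x => (E ^+ 2)^-1 * (- 2 * f x)).
    by apply/funext => t; rewrite /f phiL exprMn invfM -/E; ring.
  rewrite e in w1; apply: (wd_unique w1 w2 (c := 0)).
  rewrite /= add0r /z P0 /c1; field.
  by rewrite !gt_eqF// ?subr_gt0// (lt_trans ltr01).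
(* [z] decreases, yet a period multiplies it by the constant [(E ^+ 2)^-1 < 1]; this forces
   [z > 0]. *)
have z0 x : 0 < z x.
  have : 0 < P (x + L) - P x by rewrite wP.2 ?lerDl ?ltW// int_gt0// ltrDl.
  have -> : P (x + L) - P x = (z x - z (x + L)) / 2 by rewrite /z; field.
  rewrite zL -{1}[z x]mul1r -mulrBl mulrAC pmulr_rgt0//.
  by rewrite divr_gt0// subr_gt0 invf_lt1.
have dz x : is_derive x (1 : R) z (- 2 * f x).
  by apply: (wd_derive wz); apply: continuousZ_fun.
have cz := wd_continuous wz.
pose w0 x := phi x * phi x * z x.
have w00 x : 0 < w0 x by apply: mulr_gt0 (mulr_gt0 (phi0 x) (phi0 x)) (z0 x).
have dw0 x : is_derive x (1 : R) w0 (2 * u x * w0 x - 2).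
  have := is_derive1M (is_derive1M (dphi x) (dphi x)) (dz x).
  by move/is_derive_eq; apply; rewrite /w0 /f; field; rewrite gt_eqF.
have cw0 : continuous w0 by move=> x; exact: is_derive_continuous (dw0 x).
have pw0 : periodic w0 L.
  by move=> x; rewrite /w0 phiL zL -/E; field; rewrite gt_eqF// (lt_trans ltr01).
pose N := \int[mu]_(t in `[0, L]) w0 t.
have N0 : 0 < N by exact: int_gt0.
pose w x := N^-1 * w0 x; pose dw x := N^-1 * (2 * u x * w0 x - 2).
have tw : test_function L w dw.
  split.
  - by move=> x; exact: is_derive1Z.
  - apply: continuousZ_fun; apply: continuousB_fun; last exact: continuous_cst_fun.
    by apply: continuousM_fun => //; exact: continuousZ_fun.
  - by move=> x; rewrite /w pw0.
  - by move=> x; rewrite mulr_gt0// invr_gt0.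
  - by rewrite intZ ?mulVf ?gt_eqF//; exact: li_continuous.
exists w, dw; split => //.
have cw := test_fun_continuous tw; have cdw := test_continuous tw.
have wp := test_gt0 tw.
have lV : li (fun t => (w t)^-1) by apply: li_continuous; exact: continuousV_fun.
rewrite (riccati_identity tw) addrC; congr (_ + _).
rewrite (@eq_int _ _ (fun t => N^-1 ^+ 2 * (w t)^-1)); last first.
  move=> t _; congr (_ / _).
  have -> : dw t / 2 - u t * w t = - N^-1 by rewrite /dw /w; move: (N^-1) => r; field.
  by rewrite sqrrN.
rewrite intZ// /harmonic_ratio; set T := (\int[mu]_(t in _) _).
have T0 : 0 < T by exact: inv_test_int_gt0 tw.
(* Periodicity of ln w identifies the normalisation, [l * L = N^-1 * T], so the remainder
   [N^-1 ^+ 2 * T] is the harmonic term. *)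
have : \int[mu]_(t in `[0, L]) (dw t / w t) = 0.
  by apply: (int_dlog L0 (test_periodic tw) (test_derive tw)).
rewrite (@eq_int _ _ (fun t => 2 * u t - (2 * N^-1) * (w t)^-1)); last first.
  by move=> t _; rewrite /dw /w; field; rewrite !gt_eqF.
rewrite intB; [|by apply: li_continuous; exact: continuousZ_fun|exact: liZ].
rewrite !intZ//; last exact: li_continuous.
rewrite int_u -/T => e.
have -> : l ^+ 2 * (L ^+ 2 / T) = (l * L) ^+ 2 / T by ring.
have -> : l * L = N^-1 * T by lra.
by field; rewrite !gt_eqF.
Qed.

End Eigenpair.
End Variational.

(** * Exchange of minimum and maximum *)

Section Minimax.
Context {R : realType}.
Implicit Types (D : set (R * R)) (a b c l t : R).

(* The supremum over [D] of [l ^ 2 a + b], divided by [l] and minimised over [l],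
   is controlled by [2 sqrt (a b)] at a single point of [D]: at the minimal [l]
   one has [l ^ 2 a = b], up to mixing two nearby maximisers. *)
Lemma concave_minimax D (kap : R -> R) c :
  (forall a b, D (a, b) -> 0 <= a <= 1) ->
  (forall a1 b1 a2 b2 t, D (a1, b1) -> D (a2, b2) -> 0 <= t <= 1 ->
    exists a b, [/\ D (a, b), (1 - t) * a1 + t * a2 <= a & (1 - t) * b1 + t * b2 <= b]) ->
  0 < c ->
  (forall l, 0 < l -> exists a b, D (a, b) /\ kap l = l ^+ 2 * a + b) ->
  (forall l a b, 0 < l -> D (a, b) -> l ^+ 2 * a + b <= kap l) ->
  (forall l, 0 < l -> c * l <= kap l) ->
  (forall l, 0 < l -> l ^+ 2 <= kap l) ->
  forall e, 0 < e -> exists a b, [/\ D (a, b), 0 <= b & c ^+ 2 - e <= 4 * (a * b)].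
Proof.
move=> D01 Dmix c0 kapE kap_ge kapc kap2 e e0.
(* Just below [sup X] some maximizer has [l ^ 2 * a <= b]; above it every maximizer has the opposite
   inequality, and mixing two such points gives balance. At [c / 2] the sum is at least [c ^ 2 / 2]
   while [l ^ 2 * a <= c ^ 2 / 4], so [X] is not empty. *)
pose X := [set l | 0 < l /\ exists a b,
  [/\ D (a, b), kap l = l ^+ 2 * a + b & l ^+ 2 * a <= b]].
have Xc : X (c / 2).
  have c20 : 0 < c / 2 by lra.
  split => //; have [a [b [Dab kE]]] := kapE _ c20.
  exists a, b; split => //; have := kapc _ c20; rewrite kE.
  by have /andP[? ?] := D01 _ _ Dab; nra.
have k1 : 1 <= kap 1 by have := kap2 1 ltr01; rewrite expr1n.
(* On [X], [l ^ 2 <= kap l <= 2 * b] and [b <= kap 1]. *)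
pose U := 1 + 2 * kap 1.
have uX : ubound X U.
  move=> l [l0 [a [b [Dab kE lab]]]].
  have := kap_ge 1 a b ltr01 Dab; have := kap2 _ l0; rewrite kE expr1n mul1r => h1 h2.
  have /andP[a0 a1] := D01 _ _ Dab.
  have l2 : l ^+ 2 <= 2 * kap 1 by lra.
  rewrite -(ler_pXn2r (n := 2))// ?nnegrE ?(ltW l0)//; last by rewrite /U; lra.
  apply: le_trans l2 _; rewrite /U; nra.
have hX : has_sup X by split; [exists (c / 2)|exists U].
have sU : sup X <= U by apply: ge_sup => //; exists (c / 2).
have cs : c / 2 <= sup X by apply: ub_le_sup => //; exists U.
have cc0 : 0 < c * c by rewrite mulr_gt0.
pose ep := Num.min (e / 8) (c * c / 4).
have ep0 : 0 < ep by rewrite /ep lt_min; apply/andP; split; lra.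
have epe : ep <= e / 8 by rewrite /ep ge_min lexx.
have epc : ep <= c * c / 4 by rewrite /ep ge_min lexx orbT.
have U0 : 0 < 2 * (2 * U + 1) by rewrite /U; lra.
(* [l1] and [l2] differ by at most [2 * d] and sum to at most [2 * U + 1], so their squares differ
   by at most [ep]; [d <= c / 4] keeps [l1 >= c / 4]. *)
pose d := Num.min (Num.min 1 (c / 4)) (ep / (2 * (2 * U + 1))).
have d0 : 0 < d by rewrite /d !lt_min ltr01 divr_gt0//= divr_gt0.
have d1 : d <= 1 by rewrite /d !ge_min lexx.
have dc : d <= c / 4 by rewrite /d !ge_min lexx orbT.
have de : d * (2 * (2 * U + 1)) <= ep by rewrite -ler_pdivlMr// /d !ge_min lexx !orbT.
have [l1 [l10 [a1 [b1 [D1 k1E h1]]]] sl1] := sup_adherent d0 hX.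
have l1s : l1 <= sup X by apply: ub_le_sup; [exists U|split => //; exists a1, b1].
pose l2 := sup X + d.
have l20 : 0 < l2 by rewrite /l2; lra.
have [a2 [b2 [D2 k2E]]] := kapE _ l20.
have h2 : b2 < l2 ^+ 2 * a2.
  rewrite ltNge; apply/negP => h2.
  have : l2 <= sup X by apply: ub_le_sup; [exists U|split => //; exists a2, b2].
  by rewrite /l2; lra.
have l12 : l2 ^+ 2 - l1 ^+ 2 <= ep.
  apply: le_trans de; rewrite subr_sqr; apply: (@le_trans _ _ (2 * d * (2 * U + 1))); last lra.
  by apply: ler_pM; rewrite /l2; lra.
have /andP[a10 a11] := D01 _ _ D1.
have /andP[a20 a21] := D01 _ _ D2.
have l1c : c / 4 <= l1 by lra.
have l1sq : 0 < l1 ^+ 2 by rewrite exprn_gt0.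
pose x1 := l1 ^+ 2 * a1; pose x2 := l1 ^+ 2 * a2.
have x10 : 0 <= x1 by rewrite mulr_ge0// ltW.
have x20 : 0 <= x2 by rewrite mulr_ge0// ltW.
have l12' : l1 ^+ 2 <= l2 ^+ 2.
  by rewrite ler_pXn2r ?nnegrE ?(ltW l10) ?(ltW l20)// /l2; lra.
have x2l : l2 ^+ 2 * a2 <= x2 + ep.
  by rewrite /x2 -lerBlDl -mulrBl; apply: le_trans l12; rewrite ler_piMr// subr_ge0.
have xy1 : c * l1 <= x1 + b1 by rewrite /x1 -k1E; exact: kapc.
have xy2 : c * l1 - ep <= x2 + b2.
  have := kapc _ l20; rewrite k2E; have : c * l1 <= c * l2.
    by rewrite ler_pM2l// /l2; lra.
  by lra.
have cl : ep <= c * l1.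
  apply: le_trans epc _; rewrite -mulrA ler_pM2l//.
(* Near equality in AM-GM, from [4 * x * y = (x + y) ^ 2 - (x - y) ^ 2]; the error [2 * c * l1 * ep]
   is at most [l1 ^ 2 * e] because [c <= 4 * l1] and [ep <= e / 8]. *)
have fin a b x y : D (a, b) -> 0 <= x -> 0 <= y -> x <= l1 ^+ 2 * a -> y <= b ->
    c * l1 - ep <= x + y -> `|x - y| <= ep -> c ^+ 2 - e <= 4 * (a * b).
  move=> Dab x0 y0 xa yb xye dxy.
  rewrite -(ler_pM2l l1sq).
  have h3 : x * y <= l1 ^+ 2 * a * b by rewrite ler_pM.
  have h4 : (c * l1 - ep) ^+ 2 <= (x + y) ^+ 2.
    by rewrite ler_pXn2r ?nnegrE ?subr_ge0// addr_ge0.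
  have h5 : (x - y) ^+ 2 <= ep ^+ 2.
    by rewrite -[(x - y) ^+ 2]real_normK ?num_real// ler_pXn2r ?nnegrE// (ltW ep0).
  have h6 : 2 * (c * l1) * ep <= l1 ^+ 2 * e.
    have : 2 * (c * l1) * ep <= 2 * (4 * l1 * l1) * ep.
      rewrite ler_pM2r// ler_pM2l//; rewrite ler_pM2r//; lra.
    have : l1 ^+ 2 * ep <= l1 ^+ 2 * (e / 8) by rewrite ler_pM2l.
    by rewrite expr2; lra.
  move: h3 h4 h5 h6; rewrite !expr2; lra.
have [le|lt] := leP x2 b2.
  exists a2, b2; split => //; first exact: le_trans le.
  apply: (fin a2 b2 x2 b2) => //; first exact: le_trans le.
  by rewrite distrC ger0_norm ?subr_ge0//; lra.
(* The weight at which the mixed second coordinate equals [l1 ^ 2] times the mixed first one. *)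
pose th := (b1 - x1) / ((b1 - x1) + (x2 - b2)).
have b1x1 : 0 <= b1 - x1 by rewrite subr_ge0.
have den : 0 < (b1 - x1) + (x2 - b2) by rewrite ltr_wpDl// subr_gt0.
have th0 : 0 <= th by rewrite divr_ge0// ltW.
have th1 : th <= 1 by rewrite ler_pdivrMr// mul1r lerDl subr_ge0 ltW.
have [|a [b [Dab ha hb]]] := Dmix _ _ _ _ th D1 D2; first by rewrite th0.
pose x := (1 - th) * x1 + th * x2.
have xE : (1 - th) * b1 + th * b2 = x by rewrite /x /th; field; rewrite gt_eqF.
have x0 : 0 <= x by rewrite /x addr_ge0// mulr_ge0// subr_ge0.
exists a, b; split => //; first by apply: le_trans hb; rewrite xE.
apply: (fin a b x x) => //.
- have -> : x = l1 ^+ 2 * ((1 - th) * a1 + th * a2) by rewrite /x /x1 /x2; ring.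
  by rewrite ler_pM2l.
- by rewrite -xE.
- rewrite -{2}xE /x addrACA -!mulrDr.
  have : (1 - th) * (c * l1 - ep) <= (1 - th) * (x1 + b1).
    by rewrite ler_wpM2l ?subr_ge0//; lra.
  have : th * (c * l1 - ep) <= th * (x2 + b2) by rewrite ler_wpM2l.
  lra.
- by rewrite subrr normr0 ltW.
Qed.

End Minimax.

Section SpeedAndAction.
Context {R : realType}.
Notation mu := (@lebesgue_measure R).
Notation li := (@locally_integrable R [set: R]).
Implicit Types (L l k x : R) (b w dw : R -> R).

Lemma harmonic_ratio_gt0 L w dw : 0 < L -> test_function L w dw -> 0 < harmonic_ratio L w.
Proof.
move=> L0 tw; rewrite /harmonic_ratio divr_gt0// ?exprn_gt0//.
exact: inv_test_int_gt0 tw.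
Qed.

Lemma harmonic_ratio_le1 L w dw : 0 < L -> test_function L w dw -> harmonic_ratio L w <= 1.
Proof.
move=> L0 tw; have T0 := inv_test_int_gt0 L0 tw.
have cw := test_fun_continuous tw; have w0 := test_gt0 tw.
rewrite ler_pdivrMr// mul1r.
have lV : li (fun t => (w t)^-1) by apply: li_continuous; exact: continuousV_fun.
have lw : li w by exact: li_continuous.
have : 0 <= \int[mu]_(t in `[0, L]) ((L * w t - 1) ^+ 2 / w t).
  by apply: int_ge0 => t _; rewrite divr_ge0 ?sqr_ge0// ltW.
rewrite (@eq_int _ _ (fun t => (w t)^-1 + (L ^+ 2 * w t - 2 * L))); last first.
  by move=> t _; field; rewrite gt_eqF.
rewrite intD//; last by apply: liB; [exact: liZ|exact: li_cst].
rewrite intB; [|exact: liZ|exact: li_cst].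
rewrite intZ// (test_mass tw) int_cst ?(ltW L0)// subr0 mulr1 !expr2; lra.
Qed.

Lemma test_function_cst L : 0 < L -> test_function L (fun=> L^-1) (fun=> 0).
Proof.
move=> L0; split => //.
- by move=> x; exact: is_derive_cst.
- exact: continuous_cst_fun.
- by move=> x; rewrite invr_gt0.
- by rewrite int_cst ?(ltW L0)// subr0 mulVf// gt_eqF.
Qed.

Lemma harmonic_ratio_cst L : 0 < L -> harmonic_ratio L (fun=> L^-1) = 1.
Proof.
move=> L0; rewrite /harmonic_ratio int_cst ?(ltW L0)// invrK subr0 -expr2 divff//.
by rewrite expf_neq0// gt_eqF.
Qed.

Lemma dissipation_cst L : 0 < L -> dissipation L (fun=> L^-1) (fun=> 0) = 0.
Proof.
move=> L0; rewrite /dissipation (@eq_int _ _ (fun=> 0)) ?int_cst ?mul0r ?(ltW L0)//.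
by move=> x _; rewrite expr0n/= mul0r.
Qed.

Lemma action_cst_ge0 L b : 0 < L -> (forall x, 0 <= b x) ->
  0 <= action L b (fun=> L^-1) (fun=> 0).
Proof.
move=> L0 b0; rewrite /action dissipation_cst// subr0.
by apply: int_ge0 => x _; rewrite mulr_ge0// invr_ge0 ltW.
Qed.

Section Mix.
Variables (L t : R) (b w1 dw1 w2 dw2 : R -> R).
Hypotheses (L0 : 0 < L) (lb : li b) (t01 : 0 <= t <= 1)
  (tw1 : test_function L w1 dw1) (tw2 : test_function L w2 dw2).

Let w x := (1 - t) * w1 x + t * w2 x.
Let dw x := (1 - t) * dw1 x + t * dw2 x.

Let t0 : 0 <= t. Proof. by case/andP : t01. Qed.
Let t1 : 0 <= 1 - t. Proof. by rewrite subr_ge0; case/andP : t01. Qed.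
Let cw1 := test_fun_continuous tw1.
Let cw2 := test_fun_continuous tw2.
Let lw1 : li w1. Proof. exact: li_continuous. Qed.
Let lw2 : li w2. Proof. exact: li_continuous. Qed.

Lemma test_function_mix : test_function L w dw.
Proof.
have w10 := test_gt0 tw1; have w20 := test_gt0 tw2.
split.
- move=> x; apply: is_derive1D; apply: is_derive1Z; [exact: test_derive tw1 x|].
  exact: test_derive tw2 x.
- apply: continuousD_fun; apply: continuousZ_fun.
    exact: test_continuous tw1.
  exact: test_continuous tw2.
- by move=> x; rewrite /w (test_periodic tw1) (test_periodic tw2).
- move=> x; rewrite /w; move: t01; rewrite le_eqVlt => /andP[/predU1P[<- _|tp t1']].
    by rewrite subr0 mul1r mul0r addr0.
  by apply: ltr_wpDl; [rewrite mulr_ge0 ?(ltW (w10 x))|rewrite mulr_gt0].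
- rewrite /w intD; [|exact: liZ..].
  by rewrite !intZ// (test_mass tw1) (test_mass tw2); ring.
Qed.

(** The map (p, q) |-> p^2 / q is jointly convex for q > 0; the convexity defect of the dissipation
    density is an explicit nonnegative fraction. *)
Lemma action_mix : (1 - t) * action L b w1 dw1 + t * action L b w2 dw2 <= action L b w dw.
Proof.
have tw := test_function_mix; have w10 := test_gt0 tw1; have w20 := test_gt0 tw2.
have w0 := test_gt0 tw; have cw := test_fun_continuous tw.
rewrite /action.
have -> : \int[mu]_(s in `[0, L]) (w s * b s) =
   (1 - t) * \int[mu]_(s in `[0, L]) (w1 s * b s) + t * \int[mu]_(s in `[0, L]) (w2 s * b s).
  rewrite -!intZ; [|exact: liM_continuous..].
  rewrite -intD; [|by apply: liZ; exact: liM_continuous..].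
  by apply: eq_int => s _; rewrite /w; ring.
suff : dissipation L w dw <= (1 - t) * dissipation L w1 dw1 + t * dissipation L w2 dw2.
  lra.
have l1 := li_continuous (continuous_dissipation tw1).
have l2 := li_continuous (continuous_dissipation tw2).
rewrite /dissipation -!intZ// -intD; [|exact: liZ..].
apply: int_le.
- exact: li_continuous (continuous_dissipation tw).
- by apply: liD; exact: liZ.
- move=> x _; rewrite -subr_ge0.
  have -> : (1 - t) * (dw1 x ^+ 2 / (4 * w1 x)) + t * (dw2 x ^+ 2 / (4 * w2 x)) -
      dw x ^+ 2 / (4 * w x) =
      t * (1 - t) * (dw1 x * w2 x - dw2 x * w1 x) ^+ 2 / (4 * w1 x * w2 x * w x).
    have := w0 x; rewrite /dw /w => wx0; field.
    by rewrite !gt_eqF.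
  apply: divr_ge0; first by rewrite mulr_ge0 ?sqr_ge0// mulr_ge0.
  by apply/ltW/mulr_gt0 => //; apply/mulr_gt0 => //; exact/mulr_gt0.
Qed.

(* With [T = int 1/w], [1/T] is the minimum of [int g^2 w] over the [g] of
   integral 1, attained at [g = 1/(T w)]: a minimum of functions linear in [w]. *)
Lemma harmonic_ratio_mix :
  (1 - t) * harmonic_ratio L w1 + t * harmonic_ratio L w2 <= harmonic_ratio L w.
Proof.
have tw := test_function_mix.
have w0 := test_gt0 tw; have cw := test_fun_continuous tw.
have T0 := inv_test_int_gt0 L0 tw.
rewrite /harmonic_ratio; set T := (\int[mu]_(s in _) (w s)^-1) in T0 *.
have cV := continuousV_fun cw w0.
have lV := li_continuous cV.
pose g s := T^-1 * (w s)^-1.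
have cg : continuous g by exact: continuousZ_fun.
have lg := li_continuous cg.
have ig : \int[mu]_(s in `[0, L]) g s = 1 by rewrite intZ// mulVf// gt_eqF.
have key v dv : test_function L v dv ->
    (\int[mu]_(s in `[0, L]) (v s)^-1)^-1 <= \int[mu]_(s in `[0, L]) (g s ^+ 2 * v s).
  move=> tv; have v0 := test_gt0 tv; have cv := test_fun_continuous tv.
  have := inv_test_int_gt0 L0 tv; set V := (\int[mu]_(s in _) (v s)^-1) => V0.
  have lvV : li (fun s => (v s)^-1) by apply: li_continuous; exact: continuousV_fun.
  have lgv : li (fun s => g s ^+ 2 * v s).
    by apply: li_continuous; apply: continuousM_fun => //; exact: continuousM_fun.
  have : 0 <= \int[mu]_(s in `[0, L]) ((g s * v s - V^-1) ^+ 2 / v s).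
    by apply: int_ge0 => s _; rewrite divr_ge0 ?sqr_ge0// ltW.
  rewrite (@eq_int _ _ (fun s =>
    g s ^+ 2 * v s - (2 * V^-1 * g s - V^-1 ^+ 2 * (v s)^-1))); last first.
    by move=> s _; move: (V^-1) (g s) => r gs; field; rewrite gt_eqF.
  rewrite intB//; last by apply: liB; exact: liZ.
  rewrite intB; [|exact: liZ..].
  rewrite (intZ _ _ _ lg) (intZ _ _ _ lvV) ig -/V.
  have -> : V^-1 ^+ 2 * V = V^-1 by field; rewrite gt_eqF.
  by lra.
have h1 := key _ _ tw1; have h2 := key _ _ tw2.
have e : (1 - t) * \int[mu]_(s in `[0, L]) (g s ^+ 2 * w1 s) +
    t * \int[mu]_(s in `[0, L]) (g s ^+ 2 * w2 s) = T^-1.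
  have lgv v : continuous v -> li (fun s => g s ^+ 2 * v s).
    by move=> cv; apply: li_continuous; apply: continuousM_fun => //; exact: continuousM_fun.
  rewrite -!intZ; [|exact: lgv..].
  rewrite -intD; [|by apply: liZ; exact: lgv..].
  rewrite (@eq_int _ _ (fun s => T^-1 * g s)); first by rewrite (intZ _ _ _ lg) ig mulr1.
  have T00 : T != 0 by rewrite gt_eqF.
  move=> s _; transitivity (g s ^+ 2 * w s); first by rewrite /w; ring.
  by rewrite /g; have := gt_eqF (w0 s); move: (w s) => ws wn; field; rewrite T00 wn.
have L2 : 0 <= L ^+ 2 by exact: sqr_ge0.
have : (1 - t) * (\int[mu]_(s in `[0, L]) (w1 s)^-1)^-1 +
       t * (\int[mu]_(s in `[0, L]) (w2 s)^-1)^-1 <= T^-1.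
  by rewrite -e; apply: lerD; rewrite ler_wpM2l.
move/(ler_wpM2l L2); apply: le_trans; rewrite le_eqVlt; apply/orP; left.
by apply/eqP; ring.
Qed.

End Mix.

Lemma principal_eigenvalue_neq0 L l b : principal_eigenvalue L l b != 0 ->
  is_principal_eigenvalue L l b (principal_eigenvalue L l b).
Proof.
rewrite /principal_eigenvalue; case: (pselect (exists k, is_principal_eigenvalue L l b k)).
  by move=> ex _; exact: (@xgetPex _ 0 _ ex).
move=> nex /eqP[]; apply: xgetPN => k Pk; apply: nex; by exists k.
Qed.

(** [concave_minimax] applied to the pairs of [harmonic_ratio] and [action]. Positive speed makes
    every eigenvalue nonzero, so none is a default value; the constant test function gives the lower
    bound [l ^ 2] on minus the eigenvalue. *)
Lemma minimal_speed_action L b e : 0 < L -> li b -> (forall x, 0 <= b x) ->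
  0 < minimal_speed L b -> 0 < e -> exists w dw, [/\ test_function L w dw,
    0 <= action L b w dw &
    minimal_speed L b ^+ 2 - e <= 4 * (harmonic_ratio L w * action L b w dw)].
Proof.
move=> L0 lb b0 c0 e0; set c := minimal_speed L b in c0 *.
pose S := [set - principal_eigenvalue L lambda b / lambda | lambda in
        [set lambda : R | 0 < lambda]].
(* [inf] returns 0 on a set without infimum, which [c0] excludes. *)
have hS : has_inf S.
  by have [//|nS] := pselect (has_inf S); move: c0; rewrite /c /minimal_speed inf_out// ltxx.
have cS l : 0 < l -> c * l <= - principal_eigenvalue L l b.
  move=> l0; rewrite -ler_pdivlMr//; apply: ge_inf; first by case: hS.
  by exists l.
have ex l : 0 < l -> is_principal_eigenvalue L l b (principal_eigenvalue L l b).
  move=> l0; apply: principal_eigenvalue_neq0.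
  have := cS l l0; have : 0 < c * l by rewrite mulr_gt0.
  by move=> h1 h2; rewrite lt_eqF//; lra.
pose D := [set ab : R * R | exists w dw, [/\ test_function L w dw,
  ab.1 = harmonic_ratio L w & ab.2 = action L b w dw]].
have [|||||a [b' [[w [dw [tw /= -> ->]]] h1 h2]]] :=
  @concave_minimax R D (fun l => - principal_eigenvalue L l b) c _ _ c0 _ _ cS _ e e0.
- move=> a b' [w [dw [tw /= -> _]]].
  by rewrite (harmonic_ratio_le1 L0 tw) (ltW (harmonic_ratio_gt0 L0 tw)).
- move=> a1 b1 a2 b2 t [w1 [dw1 [tw1 /= -> ->]]] [w2 [dw2 [tw2 /= -> ->]]] t01.
  eexists; eexists; split.
  + eexists; eexists; split; [exact: (test_function_mix t01 tw1 tw2)|reflexivity..].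
  + exact: (harmonic_ratio_mix L0 t01 tw1 tw2).
  + exact: (action_mix lb t01 tw1 tw2).
- move=> l l0; have [psi [ppsi psi0 eig]] := ex l l0.
  have [w [dw [tw E]]] := eigenvalue_attained L0 lb ppsi psi0 eig l0.
  by exists (harmonic_ratio L w), (action L b w dw); split => //; exists w, dw.
- move=> l a b' l0 [w [dw [tw /= -> ->]]].
  have [psi [ppsi psi0 eig]] := ex l l0.
  exact: eigenvalue_ge L0 lb ppsi psi0 eig _ _ tw.
- move=> l l0; have [psi [ppsi psi0 eig]] := ex l l0.
  have := eigenvalue_ge L0 lb ppsi psi0 eig (test_function_cst L0).
  rewrite harmonic_ratio_cst// mulr1; have := action_cst_ge0 L0 b0; lra.
by exists w, dw.
Qed.

End SpeedAndAction.

(** * Bounds on test functions in terms of the dissipation *)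

Section TestFunctionBounds.
Context {R : realType}.
Notation mu := (@lebesgue_measure R).
Notation li := (@locally_integrable R [set: R]).
Implicit Types (L x y : R) (b w dw : R -> R).

Lemma sub_int_le L a c f : li f -> (forall x, 0 <= f x) -> 0 <= a -> a <= c -> c <= L ->
  \int[mu]_(t in `[a, c]) f t <= \int[mu]_(t in `[0, L]) f t.
Proof.
move=> lf f0 a0 ac cL.
rewrite (int_split lf a0 (le_trans ac cL)) (int_split lf ac cL).
have h1 : 0 <= \int[mu]_(t in `[0, a]) f t by apply: int_ge0.
have h2 : 0 <= \int[mu]_(t in `[c, L]) f t by apply: int_ge0.
lra.
Qed.

Section Bounds.
Variables (L : R) (w dw : R -> R).
Hypothesis tw : test_function L w dw.
Let D := dissipation L w dw.
Let w0 := test_gt0 tw.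
Let cw := test_fun_continuous tw.
Let cdw := test_continuous tw.

Lemma dissipation_ge0 : 0 <= D.
Proof. by apply: int_ge0 => x _; rewrite divr_ge0 ?sqr_ge0// mulr_ge0// ltW. Qed.

(** Cauchy-Schwarz for the derivative [dal] of sqrt w, whose square integrates to [D]; it is
    obtained by expanding the square of [dal] minus its mean slope [m]. *)
Lemma sqrt_test_holder x y : 0 <= x <= L -> 0 <= y <= L ->
  (Num.sqrt (w x) - Num.sqrt (w y)) ^+ 2 <= D * `|x - y|.
Proof.
wlog yx : x y / y <= x.
  move=> W xL yL; have [/W|/ltW/W] := leP y x; first exact.
  by rewrite -sqrrN opprB distrC; exact.
move=> /andP[x0 xL] /andP[y0 yL].
move: yx; rewrite le_eqVlt => /predU1P[->|yx].
  by rewrite !subrr normr0 mulr0 expr0n.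
pose al z := Num.sqrt (w z); pose dal z := dw z / (2 * Num.sqrt (w z)).
have al0 z : 0 < al z by rewrite sqrtr_gt0.
have cal : continuous al.
  move=> z; apply: (@continuous_comp R R R w (@Num.sqrt R)); first exact: cw.
  exact: sqrt_continuous.
have hal z : is_derive z (1 : R) al (dal z).
  have := @is_derive1_comp R _ w z _ _ (is_derive1_sqrt (w0 z)) (test_derive tw z).
  by move/is_derive_eq; apply; rewrite /dal mulrC.
have cdal : continuous dal.
  apply: continuous_div_fun => //; first exact: continuousZ_fun.
  by move=> z; apply: mulr_gt0 (al0 z).
have dal2 z : dal z ^+ 2 = dw z ^+ 2 / (4 * w z).
  rewrite /dal expr_div_n exprMn sqr_sqrtr ?(ltW (w0 z))//.
  by congr (_ / (_ * _)); rewrite expr2 -natrM.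
have wal := derive_wd hal cdal.
rewrite -/(al x) -/(al y) gtr0_norm ?subr_gt0//.
set h := x - y; have h0 : 0 < h by rewrite subr_gt0.
pose m := (al x - al y) / h.
have lda : li (fun t => dal t ^+ 2).
  by apply: li_continuous; exact: continuousM_fun.
have : 0 <= \int[mu]_(t in `[y, x]) ((dal t - m) ^+ 2).
  by apply: int_ge0 => t _; exact: sqr_ge0.
rewrite (@eq_int _ _ (fun t => dal t ^+ 2 - (2 * m * dal t - m ^+ 2))); last first.
  by move=> t _; ring.
rewrite intB//; last by apply: liB; [apply: liZ; exact: li_continuous|exact: li_cst].
rewrite intB; [|by apply: liZ; exact: li_continuous|exact: li_cst].
rewrite intZ; last exact: li_continuous.
rewrite int_cst ?(ltW yx)// -wal.2 ?(ltW yx)// -/h.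
have : \int[mu]_(t in `[y, x]) (dal t ^+ 2) <= D.
  rewrite /D /dissipation (@eq_int _ (fun t => dw t ^+ 2 / _) (fun t => dal t ^+ 2)) //.
  by apply: sub_int_le => // [t|]; [exact: sqr_ge0|exact: ltW].
set I := \int[mu]_(t in _) _ => ID.
have -> : al x - al y = m * h by rewrite /m divfK// gt_eqF.
move=> H; have {H} : m ^+ 2 * h <= I by rewrite expr2 in H *; lra.
move=> H; rewrite exprMn (expr2 h) mulrA ler_pM2r//; exact: le_trans H ID.
Qed.

(** Unit mass yields a point within distance [r] of [x] where [w <= r^-1], and the Holder bound on
    sqrt w reaches [x] from there. The free [r] makes the factor of [D] as small as desired. *)
Lemma test_function_le (r : R) x : 0 < r -> r <= L -> 0 <= x <= L ->
  w x <= 2 / r + 2 * r * D.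
Proof.
move=> r0 rL /andP[x0 xL].
pose a := if x + r <= L then x else L - r.
have [a0 ax xa aL] : [/\ 0 <= a, a <= x, x <= a + r & a + r <= L].
  by rewrite /a; case: (leP (x + r) L) => h; split; lra.
have aar : a <= a + r by rewrite lerDl ltW.
have [|y yI ymin] := @EVT_min R w a (a + r) aar; first exact: continuous_subspaceT.
move: yI; rewrite in_itv/= => /andP[ay ya].
have wy : w y * r <= 1.
  rewrite -(test_mass tw); apply: (@le_trans _ _ (\int[mu]_(t in `[a, a + r]) w t)).
    have <- : \int[mu]_(t in `[a, a + r]) w y = w y * r by rewrite int_cst//; ring.
    apply: int_le; [exact: li_cst|exact: li_continuous|].
    by move=> t tI; apply: ymin; rewrite in_itv.
  by apply: sub_int_le => // [|t]; [exact: li_continuous|exact: ltW].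
have xL' : 0 <= x <= L by rewrite x0.
have yL' : 0 <= y <= L by apply/andP; split; lra.
have H := sqrt_test_holder xL' yL'.
have xy : `|x - y| <= r by rewrite ler_norml; apply/andP; split; lra.
have DH : D * `|x - y| <= D * r by rewrite ler_wpM2l// dissipation_ge0.
have wy' : w y <= r^-1 by rewrite -[leRHS]mul1r ler_pdivlMr.
have := sqr_sqrtr (ltW (w0 x)); have := sqr_sqrtr (ltW (w0 y)).
move: H; set p := Num.sqrt (w x); set q := Num.sqrt (w y) => H q2 p2.
have : p ^+ 2 <= 2 * q ^+ 2 + 2 * (p - q) ^+ 2.
  have : 0 <= (p - 2 * q) ^+ 2 by exact: sqr_ge0.
  by rewrite !expr2; lra.
by rewrite p2 q2; lra.
Qed.

Lemma test_function_holder W x y : (forall z, 0 <= z <= L -> w z <= W) ->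
  0 <= x <= L -> 0 <= y <= L -> (w x - w y) ^+ 2 <= 4 * W * D * `|x - y|.
Proof.
move=> wW xL yL; have H := sqrt_test_holder xL yL.
have px := sqr_sqrtr (ltW (w0 x)); have py := sqr_sqrtr (ltW (w0 y)).
have := wW _ xL; have := wW _ yL; rewrite -px -py.
move: H; set p := Num.sqrt (w x); set q := Num.sqrt (w y) => H qW pW.
have -> : p ^+ 2 - q ^+ 2 = (p + q) * (p - q) by ring.
rewrite exprMn -mulrA; apply: ler_pM => //; rewrite ?sqr_ge0//.
have : 0 <= (p - q) ^+ 2 by exact: sqr_ge0.
by rewrite !expr2 in qW pW *; lra.
Qed.

(** A small [r] absorbs the linear term into half of the dissipation. The other half stays, so a
    nonnegative action also bounds the dissipation. *)
Lemma action_le b C r : li b -> (forall x, 0 <= b x) -> 0 < r -> r <= L ->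
  \int[mu]_(t in `[0, L]) b t <= C -> 4 * r * C <= 1 ->
  action L b w dw <= 2 * C / r - D / 2.
Proof.
move=> lb b0 r0 rL bC rC; rewrite /action -/D.
have D0 := dissipation_ge0.
have C0 : 0 <= C by apply: le_trans bC; apply: int_ge0.
pose W := 2 / r + 2 * r * D.
have W0 : 0 <= W by rewrite addr_ge0 ?mulr_ge0 ?invr_ge0// ltW.
have : \int[mu]_(t in `[0, L]) (w t * b t) <= W * C.
  apply: (@le_trans _ _ (\int[mu]_(t in `[0, L]) (W * b t))).
    apply: int_le; [exact: liM_continuous|exact: liZ|].
    by move=> x xL; rewrite ler_wpM2r// test_function_le.
  by rewrite intZ// ler_wpM2l.
have : 4 * r * C * D <= 1 * D by rewrite ler_wpM2r.
have -> : W * C = 2 * C / r + (4 * r * C * D) / 2 by rewrite /W; field; rewrite gt_eqF.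
lra.
Qed.

End Bounds.
End TestFunctionBounds.

(** * Maximizing a linear functional under the constraint *)

Section Multiplier.
Context {R : realType}.
Notation mu := (@lebesgue_measure R).
Notation li := (@locally_integrable R [set: R]).

Lemma cvg_seq_continuous (h : R -> R) (u : nat -> R) (l : R) : continuous h ->
  u n @[n --> \oo] --> l -> h (u n) @[n --> \oo] --> h l.
Proof. by move=> ch ul; apply: continuous_cvg; [exact: ch|exact: ul]. Qed.

Lemma int_bounded_cvg (u : nat -> R -> R) (v : R -> R) (a c B : R) :
  (forall n, measurable_fun [set: R] (u n)) -> (forall n x, `|u n x| <= B) ->
  (forall x, u n x @[n --> \oo] --> v x) ->
  \int[mu]_(t in `[a, c]) u n t @[n --> \oo] --> \int[mu]_(t in `[a, c]) v t.
Proof.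
move=> mf uB uv.
have vB x : `|v x| <= B.
  have h : `|u n x| @[n --> \oo] --> `|v x| by exact: cvg_norm (uv x).
  by apply: (ler_cvg_to h (cvg_cst B)); exact: nearW.
have mv : measurable_fun [set: R] v.
  by apply: (measurable_fun_cvg (h := u)) => // x _; exact: uv.
have lv : li v := li_bounded mv vB.
apply: fine_cvg; rewrite fineK; last first.
  by apply: integrable_fin_num => //; exact: li_integrable.
apply: (@dominated_cvg _ _ _ mu `[a, c]%classic _ (fun n t => (u n t)%:E)
    (EFin \o v) (cst B%:E)) => //.
- by move=> n; apply/measurable_EFinP; exact: measurable_funTS (mf n).
- by move=> x _; apply: cvg_EFin; [exact: nearW|exact: uv].
- exact: (li_integrable a c (li_cst B)).
- by move=> n x _ /=; rewrite lee_fin.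
Qed.

Lemma eq_int_oo (f g : R -> R) a c : li f -> li g ->
  (forall x, a < x < c -> f x = g x) ->
  \int[mu]_(t in `[a, c]) f t = \int[mu]_(t in `[a, c]) g t.
Proof.
move=> lf lg fg.
have h (k : R -> R) : li k ->
    \int[mu]_(t in `[a, c]) k t = \int[mu]_(t in `]a, c[) k t.
  move=> lk; have ik := li_integrable a c lk.
  rewrite -Rintegral_itv_obnd_cbnd; last first.
    by apply: integrableS ik => //; exact: subset_itv_oc_cc.
  rewrite -Rintegral_itv_bndo_bndc//.
  by apply: integrableS ik => //; exact: subset_itv_oo_cc.
rewrite (h _ lf) (h _ lg); apply: eq_Rintegral => x; rewrite inE/= in_itv/=.
exact: fg.
Qed.

Variables (L C W : R) (F w : R -> R).
Hypotheses (L0 : 0 < L) (cF : continuous F) (homoF : {homo F : x y / x <= y})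
  (sF : forall K : R, exists2 S : R, 0 < S & forall s, S <= s -> K * s <= F s)
  (cw : continuous w) (wW : forall x, 0 <= w x <= W)
  (wpos : exists2 x : R, 0 <= x <= L & 0 < w x) (F0C : L * F 0 <= C).
Implicit Types (t s m x : R) (b : R -> R).

(** [s] attains the Legendre transform of [F] at [t]. As [F] need not be convex, [s] need not be
    unique and a selection may jump. *)
Definition is_maximizer t s := 0 <= s /\ forall s', 0 <= s' -> t * s' - F s' <= t * s - F s.

Lemma maximizer_exists t : exists s, is_maximizer t s.
Proof.
have [S S0 FS] := sF (t + 1).
pose S1 := Num.max S `|F 0|.
have [||s sI smax] := @EVT_max R (fun s => t * s - F s) 0 S1.
- by rewrite le_max (ltW S0).
- apply: continuous_subspaceT; apply: continuousB_fun => //.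
  by apply: continuousZ_fun => x; exact: cvg_id.
move: sI; rewrite in_itv/= => /andP[s0 sS].
exists s; split => // s' s'0; have [s'S|s'S] := leP s' S1.
  by apply: smax; rewrite in_itv/= s'0.
have h0 : t * 0 - F 0 <= t * s - F s.
  by apply: smax; rewrite in_itv/= lexx (le_trans s0).
have h1 : (t + 1) * s' <= F s'.
  by apply: FS; rewrite (le_trans _ (ltW s'S))// le_max lexx.
have h2 : `|F 0| <= s' by rewrite (le_trans _ (ltW s'S))// le_max lexx orbT.
have := ler_norm (F 0); lra.
Qed.

(** Add the two optimality inequalities, each tested with the other maximizer. *)
Lemma maximizer_mono t s t' s' : is_maximizer t s -> is_maximizer t' s' -> t < t' -> s <= s'.
Proof.
move=> [s0 /(_ s') hs] [s'0 /(_ s) hs'] tt'.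
have := hs s'0; have := hs' s0 => h1 h2.
have : 0 <= (t' - t) * (s' - s) by lra.
by rewrite pmulr_rge0 ?subr_ge0// subr_gt0.
Qed.

Lemma maximizer_lim (tn sn : nat -> R) t s : (forall n, is_maximizer (tn n) (sn n)) ->
  tn n @[n --> \oo] --> t -> sn n @[n --> \oo] --> s -> is_maximizer t s.
Proof.
move=> hn ht hs; split.
  by apply: (ler_cvg_to (cvg_cst 0) hs); apply: nearW => n; case: (hn n).
move=> s' s'0.
have h1 : (tn n * s' - F s') @[n --> \oo] --> t * s' - F s'.
  by apply: cvgB; [apply: cvgM => //; exact: cvg_cst|exact: cvg_cst].
have h2 : (tn n * sn n - F (sn n)) @[n --> \oo] --> t * s - F s.
  by apply: cvgB; [exact: cvgM|exact: cvg_seq_continuous].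
apply: (ler_cvg_to h1 h2); apply: nearW => n; exact: (hn n).2.
Qed.

(** Any selection will do: monotonicity makes it measurable and gives it one-sided limits. *)
Let sg t := projT1 (cid (maximizer_exists t)).
Let sgP t : is_maximizer t (sg t).
Proof. exact: projT2 (cid (maximizer_exists t)). Qed.

Let sg_homo : {homo sg : t t' / t <= t'}.
Proof.
move=> t t'; rewrite le_eqVlt => /predU1P[->//|].
by apply: maximizer_mono; exact: sgP.
Qed.

Let sg0 t : 0 <= sg t. Proof. by case: (sgP t). Qed.

Let W0 : 0 <= W. Proof. by have /andP[h1 h2] := wW 0; exact: le_trans h1 h2. Qed.

Let measurable_sg m : measurable_fun [set: R] (fun x => sg (m * w x)).
Proof.
apply: (measurableT_comp (f := sg)).
  exact: nondecreasing_measurable.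
by apply: continuous_measurable_fun; exact: continuousZ_fun.
Qed.

Let sg_le m B x : 0 <= m -> m <= B -> sg (m * w x) <= sg (B * W).
Proof.
move=> m0 mB; apply: sg_homo; have /andP[w0 w1] := wW x.
exact: ler_pM.
Qed.

Let FB s B : 0 <= s -> s <= B -> `|F s| <= `|F 0| + `|F B|.
Proof.
move=> s0 sB; have h1 := homoF s0; have h2 := homoF sB.
rewrite ler_norml; apply/andP; split.
  have := ler_norm (- F 0); rewrite normrN; have := normr_ge0 (F B); lra.
by have := ler_norm (F B); have := normr_ge0 (F 0); lra.
Qed.

Let measurable_F b : measurable_fun [set: R] b -> measurable_fun [set: R] (F \o b).
Proof. by move=> mb; apply: measurableT_comp => //; exact: continuous_measurable_fun. Qed.

Let G m := \int[mu]_(x in `[0, L]) F (sg (m * w x)).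

Let limit_maximizer (mn : nat -> R) m B : (forall n, 0 <= mn n <= B) ->
  mn n @[n --> \oo] --> m ->
  (forall x, cvgn (fun n => sg (mn n * w x))) ->
  exists b, [/\ measurable_fun [set: R] b, forall x, 0 <= b x <= sg (B * W),
    forall x, is_maximizer (m * w x) (b x),
    G (mn n) @[n --> \oo] --> \int[mu]_(x in `[0, L]) F (b x) &
    \int[mu]_(x in `[0, L]) (w x * sg (mn n * w x)) @[n --> \oo] -->
      \int[mu]_(x in `[0, L]) (w x * b x)].
Proof.
move=> mnB mnm cv; pose b x := limn (fun n => sg (mn n * w x)).
have bP x : sg (mn n * w x) @[n --> \oo] --> b x by exact: cv.
have snB n x : 0 <= sg (mn n * w x) <= sg (B * W).
  by have /andP[h1 h2] := mnB n; rewrite sg0 sg_le.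
have bB x : 0 <= b x <= sg (B * W).
  apply/andP; split.
    by apply: (ler_cvg_to (cvg_cst 0) (bP x)); apply: nearW => n; case/andP: (snB n x).
  by apply: (ler_cvg_to (bP x) (cvg_cst _)); apply: nearW => n; case/andP: (snB n x).
exists b; split => //.
- by apply: (measurable_fun_cvg (h := fun n x => sg (mn n * w x))) => // x _; exact: bP.
- move=> x; apply: (maximizer_lim (tn := fun n => mn n * w x) _ _ (bP x)).
    by move=> n; exact: sgP.
  by apply: cvgM => //; exact: cvg_cst.
- apply: (int_bounded_cvg (u := fun n x => F (sg (mn n * w x)))
    (B := `|F 0| + `|F (sg (B * W))|)).
  + by move=> n; exact: measurable_F.
  + by move=> n x; have /andP[? ?] := snB n x; exact: FB.
  + by move=> x; exact: cvg_seq_continuous.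
- apply: (int_bounded_cvg (u := fun n x => w x * sg (mn n * w x)) (B := W * sg (B * W))).
  + by move=> n; apply: measurable_funM => //; exact: continuous_measurable_fun.
  + move=> n x; have /andP[? ?] := snB n x; have /andP[? ?] := wW x.
    by rewrite ger0_norm ?mulr_ge0// ler_pM.
  + by move=> x; apply: cvgM; [exact: cvg_cst|exact: bP].
Qed.

Let li_F b B : measurable_fun [set: R] b -> (forall x, 0 <= b x <= B) ->
  li (fun x => F (b x)).
Proof.
move=> mb bB; apply: (li_bounded (M := `|F 0| + `|F B|)); first exact: measurable_F.
by move=> x; have /andP[? ?] := bB x; exact: FB.
Qed.

Let li_G m : li (fun x => F (sg (m * w x))).
Proof.
apply: (li_F (B := Num.max (sg (m * 0)) (sg (m * W)))) => // x.
rewrite sg0/= le_max; have /andP[w0 w1] := wW x.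
have [m0|m0] := leP 0 m; apply/orP; [right|left]; apply: sg_homo.
  exact: ler_wpM2l.
by rewrite mulr0 nmulr_rle0.
Qed.

Let G_homo m m' : m <= m' -> G m <= G m'.
Proof.
move=> mm'; apply: int_le => [||x _]; [exact: li_G..|].
apply/homoF/sg_homo; apply: ler_wpM2r => //.
by have /andP[] := wW x.
Qed.

Lemma positive_on_segment : exists a c e : R, [/\ 0 <= a, a < c, c <= L, 0 < e &
  forall x, a <= x <= c -> e <= w x].
Proof.
have [x0 /andP[x00 x0L] wx0] := wpos.
have e0 : 0 < w x0 / 2 by lra.
have [d d0 wd] := (continuous_distP w x0).1 (@cw x0) _ e0.
have near x : x0 - d / 2 <= x <= x0 + d / 2 -> w x0 / 2 <= w x.
  move=> /andP[h1 h2]; have /wd : `|x - x0| < d by rewrite ltr_norml; apply/andP; split; lra.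
  by rewrite ltr_norml => /andP[? ?]; lra.
have [h|h] := leP (x0 + d / 2) L.
  exists x0, (x0 + d / 2), (w x0 / 2); split => //; first lra.
  by move=> x /andP[? ?]; apply: near; apply/andP; split; lra.
have [h'|h'] := leP 0 (x0 - d / 2).
  exists (x0 - d / 2), x0, (w x0 / 2); split => //; first lra.
  by move=> x /andP[? ?]; apply: near; apply/andP; split; lra.
exists 0, L, (w x0 / 2); split => //.
by move=> x /andP[? ?]; apply: near; apply/andP; split; lra.
Qed.

(** For large [m] the selected maximizers are large on a segment where [w >= e], and the constraint
    value exceeds [C]. *)
Let G_bounded : exists N, forall m, 0 <= m -> G m <= C -> m <= N.
Proof.
have [a [c [e [a0 ac cL e0 we]]]] := positive_on_segment.
have ca0 : 0 < c - a by rewrite subr_gt0.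
have [S0 S00 FS0] := sF 1.
(* Chosen so that [(K - F 0) * (c - a)] exceeds the available [C - L * F 0] by [c - a]. *)
pose K := F 0 + (C - L * F 0) / (c - a) + 1.
pose S := Num.max S0 K.
have S_gt0 : 0 < S by rewrite lt_max S00.
have FS : K <= F S.
  have := FS0 S; rewrite mul1r; move=> /(_ _)/wrap[]; first by rewrite le_max lexx.
  by apply: le_trans; rewrite le_max lexx orbT.
(* For [t > F (S + 1) - F 0] the competitor [S + 1] beats every [s < S]. *)
pose T := Num.max 0 (F (S + 1) - F 0).
exists (T / e) => m m0 GmC; rewrite leNgt; apply/negP => Tm.
have big t : m * e <= t -> S <= sg t.
  move=> met; rewrite leNgt; apply/negP => lt.
  have Tt : T < t by apply: lt_le_trans met; rewrite -ltr_pdivrMr.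
  have t0 : 0 <= t by apply: le_trans (ltW Tt); rewrite le_max lexx.
  have Ft : F (S + 1) - F 0 < t by apply: le_lt_trans Tt; rewrite le_max lexx orbT.
  have := (sgP t).2 (S + 1); move=> /(_ _)/wrap[]; first by lra.
  have := homoF (sg0 t); have : t * sg t <= t * S by rewrite ler_wpM2l// ltW.
  lra.
have lK : li (fun x => F (sg (m * w x)) - F 0).
  by apply: liB; [exact: li_G|exact: li_cst].
have h1 : \int[mu]_(x in `[a, c]) (F (sg (m * w x)) - F 0) <=
    \int[mu]_(x in `[0, L]) (F (sg (m * w x)) - F 0).
  apply: sub_int_le => //; [|exact: ltW] => x.
  by rewrite subr_ge0; exact/homoF/sg0.
have h2 : (K - F 0) * (c - a) <= \int[mu]_(x in `[a, c]) (F (sg (m * w x)) - F 0).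
  rewrite -int_cst ?(ltW ac)//; apply: int_le => //; first exact: li_cst.
  move=> x xac; rewrite lerD2r; apply: le_trans FS _; apply/homoF/big.
  by rewrite ler_wpM2l// we.
move: h1; rewrite (intB 0 L (li_G m) (li_cst (F 0))).
rewrite int_cst ?(ltW L0)// subr0 -/(G m) => h1.
have h3 : (K - F 0) * (c - a) = C - L * F 0 + (c - a).
  by rewrite /K; field; rewrite gt_eqF.
by move: ca0 GmC; lra.
Qed.

(** Integrability is a separate clause because the real-valued integral returns 0 when the extended
    one is infinite. *)
Definition constrained b := [/\ li b, forall x, 0 <= b x,
  mu.-integrable `[0, L] (EFin \o (F \o b)) &
  \int[mu]_(x in `[0, L]) F (b x) = C].

(** The pointwise optimality of [c x] against [b x], integrated: weak Lagrangian duality. *)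
Lemma maximizer_le b (c : R -> R) m B : constrained b -> measurable_fun [set: R] c ->
  (forall x, 0 <= c x <= B) -> (forall x, is_maximizer (m * w x) (c x)) ->
  m * \int[mu]_(x in `[0, L]) (w x * b x) - C <=
  m * \int[mu]_(x in `[0, L]) (w x * c x) - \int[mu]_(x in `[0, L]) F (c x).
Proof.
move=> [lb b0 iFb FbC] mc cB cmax.
have lc : li c.
  by apply: (li_bounded (M := B)) => // x; have /andP[? ?] := cB x; rewrite ger0_norm.
have lFc := li_F mc cB.
have lwb : li (fun x => w x * b x) by exact: liM_continuous.
have lwc : li (fun x => w x * c x) by exact: liM_continuous.
rewrite -(intZ _ _ _ lwb) -(intZ _ _ _ lwc) -FbC.
have i1 := li_integrable 0 L (liZ m lwb).
have i2 := li_integrable 0 L (liB (liZ m lwc) lFc).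
rewrite -(intB 0 L (liZ m lwc) lFc).
rewrite -RintegralB//; apply: le_Rintegral => //.
- pose g x := m * (w x * b x).
  have i3 : mu.-integrable `[0, L] ((EFin \o g) \- (EFin \o (F \o b)))%E.
    exact: integrableB i1 iFb.
  by apply: eq_integrable i3 => // x _; rewrite /= EFinB.
- move=> x _; have := (cmax x).2 _ (b0 x); lra.
Qed.

Lemma constrained_maximizer : exists (bs : R -> R) (B : R), [/\ measurable_fun [set: R] bs,
  forall x, 0 <= bs x <= B, \int[mu]_(x in `[0, L]) F (bs x) = C &
  forall b, constrained b ->
    \int[mu]_(x in `[0, L]) (w x * b x) <= \int[mu]_(x in `[0, L]) (w x * bs x)].
Proof.
(* At the critical multiplier [m0], the limits [bm] from the left and [bp] from
   the right of the selected maximizers are both maximizers, with constraint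
   values on either side of [C]; splicing them at a suitable [x0] gives exactly
   [C].  If [m0 = 0] the Lagrangian carries no information at [m0] itself, and
   optimality of [bp] is inherited from the positive multipliers. *)
pose X := [set m | 0 <= m /\ G m <= C].
have X0 : X 0.
  split => //; apply: le_trans F0C.
  rewrite /G (@eq_int _ _ (fun=> F (sg 0))); last by move=> x _; rewrite mul0r.
  rewrite int_cst ?(ltW L0)// subr0 mulrC ler_pM2l//.
  by have := (sgP 0).2 0 (lexx _); rewrite !mul0r; lra.
have [N GN] := G_bounded.
have hX : has_sup X by split; [exists 0|exists N => m [m0 mC]; exact: GN].
pose m0 := sup X.
have m00 : 0 <= m0 by apply: ub_le_sup => //; case: hX.
have inv1 (n : nat) : 0 <= (n.+1%:R^-1 : R) <= 1.
  by rewrite invr_ge0 ler0n invf_le1 ?ler1n.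
have inv_homo : {homo (fun n : nat => n.+1%:R^-1 : R) : n k / (n <= k)%N >-> k <= n}.
  by move=> n k nk; rewrite lef_pV2 ?posrE ?ltr0n// ler_nat.
pose mr (n : nat) : R := m0 + n.+1%:R^-1.
have mrB n : 0 <= mr n <= m0 + 1.
  by have /andP[? ?] := inv1 n; rewrite /mr addr_ge0//= lerD2l.
have mrC n : C < G (mr n).
  rewrite ltNge; apply/negP => le; have : mr n <= m0.
    apply: ub_le_sup; first by case: hX.
    by split => //; have /andP[] := mrB n.
  by rewrite /mr gerDl leNgt invr_gt0 ltr0Sn.
have mr_cvg : mr n @[n --> \oo] --> m0.
  rewrite -[X in _ --> X]addr0; apply: cvgD; first exact: cvg_cst.
  exact: cvg_harmonic.
have [|bp [mbp bpB bpmax Gbp wbp]] := limit_maximizer mrB mr_cvg.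
  move=> x; apply: nonincreasing_is_cvgn.
    move=> n k nk; apply/sg_homo; apply: ler_wpM2r; first by have /andP[] := wW x.
    by rewrite lerD2l inv_homo.
  by exists 0 => _ [n _ <-].
have bpC : C <= \int[mu]_(x in `[0, L]) F (bp x).
  by apply: (ler_cvg_to (cvg_cst C) Gbp); apply: nearW => n; exact: ltW.
have [m0_0|m0_neq0] := eqVneq m0 0.
  exists bp, (sg ((m0 + 1) * W)); split => //.
    apply/eqP; rewrite eq_le bpC andbT; apply: le_trans F0C.
    have -> : L * F 0 = \int[mu]_(x in `[0, L]) F 0 by rewrite int_cst ?(ltW L0)//; ring.
    apply: int_le; [exact: li_F bpB|exact: li_cst|] => x _.
    by have := (bpmax x).2 0 (lexx _); rewrite m0_0 !mul0r; lra.
  move=> b cb; apply: (ler_cvg_to (cvg_cst _) wbp); apply: nearW => n.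
  have mrn : 0 < mr n by rewrite /mr m0_0 add0r invr_gt0.
  have snB x : 0 <= sg (mr n * w x) <= sg ((m0 + 1) * W).
    by have /andP[h1 h2] := mrB n; rewrite sg0 sg_le.
  have := maximizer_le cb (measurable_sg (mr n)) snB (fun x => sgP (mr n * w x)).
  rewrite -/(G (mr n)) => h; rewrite -(ler_pM2l mrn); have := mrC n; lra.
have m0_gt0 : 0 < m0 by rewrite lt_neqAle eq_sym m0_neq0.
(* The multiplicative form keeps the multipliers nonnegative; the first one is 0. *)
pose ml (n : nat) : R := m0 * (1 - n.+1%:R^-1).
have mlB n : 0 <= ml n <= m0 + 1.
  have /andP[h1 h2] := inv1 n; rewrite /ml mulr_ge0 ?subr_ge0//=.
  by apply: (@le_trans _ _ m0); [rewrite ler_piMr// gerBl|rewrite lerDl].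
have mlC n : G (ml n) <= C.
  have [|m [m_ge0 GmC] mm] := sup_adherent (eps := m0 * n.+1%:R^-1) _ hX.
    by rewrite mulr_gt0// invr_gt0.
  apply: le_trans GmC; apply: G_homo; apply: ltW; apply: le_lt_trans mm.
  by rewrite /ml -/m0 mulrBr mulr1.
have ml_cvg : ml n @[n --> \oo] --> m0.
  rewrite -[X in _ --> X]mulr1 -[X in _ * X]subr0.
  apply: cvgM; first exact: cvg_cst.
  by apply: cvgB; [exact: cvg_cst|exact: cvg_harmonic].
have [|bm [mbm bmB bmmax Gbm _]] := limit_maximizer mlB ml_cvg.
  move=> x; apply: nondecreasing_is_cvgn.
    move=> n k nk; apply/sg_homo; apply: ler_wpM2r; first by have /andP[] := wW x.
    by apply: ler_wpM2l => //; rewrite lerD2l lerN2 inv_homo.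
  by exists (sg ((m0 + 1) * W)) => _ [n _ <-]; have /andP[h1 h2] := mlB n; exact: sg_le.
have bmC : \int[mu]_(x in `[0, L]) F (bm x) <= C.
  by apply: (ler_cvg_to Gbm (cvg_cst C)); exact: nearW.
have lbp := li_F mbp bpB; have lbm := li_F mbm bmB.
have [P wP P0] := wd_exists 0 0 lbp; have [Q wQ Q0] := wd_exists 0 0 lbm.
(* The constraint value of the splice at [x]: [bp] before it, [bm] after it. *)
have [||x0 x0L x0E] := @IVT R (fun x => P x + (Q L - Q x)) 0 L C (ltW L0).
- apply: continuous_subspaceT; apply: continuousD_fun; first exact: wd_continuous wP.
  apply: continuousB_fun; [exact: continuous_cst_fun|exact: wd_continuous wQ].
- rewrite (wd_itv wP (ltW L0)) (wd_itv wQ (ltW L0)) P0 Q0 !add0r subrr addr0 subr0.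
  by rewrite ge_min bmC le_max bpC orbT.
move: x0L; rewrite in_itv/= => /andP[x00 x0L].
pose bs x := if x <= x0 then bp x else bm x.
have mbs : measurable_fun [set: R] bs.
  by apply: measurable_fun_ifT => //; exact: measurable_fun_ler.
have bsB x : 0 <= bs x <= sg ((m0 + 1) * W) by rewrite /bs; case: ifP.
have bsmax x : is_maximizer (m0 * w x) (bs x) by rewrite /bs; case: ifP.
have lbs := li_F mbs bsB.
have bsC : \int[mu]_(x in `[0, L]) F (bs x) = C.
  rewrite (int_split lbs x00 x0L) -x0E wQ.2// (wd_itv wP x00) P0 add0r.
  congr (_ + _); apply: eq_int_oo => // x /andP[h1 h2]; rewrite /bs.
    by rewrite (ltW h2).
  by rewrite leNgt h1.
exists bs, (sg ((m0 + 1) * W)); split => // b cb.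
have := maximizer_le cb mbs bsB bsmax; rewrite bsC => h.
by rewrite -(ler_pM2l m0_gt0); lra.
Qed.

End Multiplier.

(** * The admissible set in terms of an extension of [f] to the line *)

Section Constraint.
Context {R : realType}.
Notation mu := (@lebesgue_measure R).
Notation li := (@locally_integrable R [set: R]).
Variables (L beta : R) (f : R -> R).
Hypotheses (L0 : 0 < L) (f_cont : {within `[0, +oo[, continuous f})
  (f_incr : {in `[0, +oo[ &, {homo f : x y / x <= y}})
  (f_superlinear : (f s / s @[s --> +oo] --> +oo)).

(** Extending [f] by the constant [f 0] makes continuity and monotonicity hold on the whole line. *)
Let F (s : R) : R := f (Num.max s 0).

Lemma extension_continuous : continuous F.
Proof.
have /continuous_within_itvcyP[f_in f_0] := f_cont.
move=> x; apply/continuous_distP => e e0; rewrite /F.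
have [x0|x0] := ltP x 0.
  exists (- x); first lra.
  move=> t; rewrite ltr_norml => /andP[_ h].
  by rewrite !max_r ?subrr ?normr0//; lra.
have [xp|xn] := ltP 0 x.
  have /continuous_distP-/(_ e e0)[d d0 fd] : {for x, continuous f}.
    by apply: f_in; rewrite in_itv/= xp.
  exists (Num.min d x); first by rewrite lt_min d0.
  move=> t; rewrite lt_min => /andP[td tx].
  rewrite max_l; first exact: fd.
  by move: tx; rewrite ltr_norml => /andP[]; lra.
have -> : x = 0 by apply/eqP; rewrite eq_le xn x0.
move/cvgrPdist_lt/(_ e e0): f_0.
rewrite /at_right near_withinE => /nbhs_ballP[d /= d0 fd].
exists d => // t; rewrite subr0 => td.
have [t0|t0] := leP t 0; first by rewrite subrr normr0.
rewrite distrC; apply: fd => //.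
by rewrite /ball/= sub0r normrN.
Qed.

Lemma extension_homo : {homo F : x y / x <= y}.
Proof.
move=> x y xy; apply: f_incr; rewrite ?in_itv/= ?andbT ?le_max ?lexx ?orbT//.
rewrite !ge_max xy lexx andbT /=; have [//|y0/=] := leP 0 y.
by apply: le_trans xy _; exact: ltW.
Qed.

Lemma extensionE s : 0 <= s -> F s = f s.
Proof. by move=> s0; rewrite /F max_l. Qed.

Lemma extension_superlinear K : exists2 S : R, 0 < S & forall s, S <= s -> K * s <= F s.
Proof.
have /cvgryPge/(_ K)[M [_ fM]] := f_superlinear.
exists (Num.max M 0 + 1); first by rewrite ltr_wpDl// le_max lexx orbT.
move=> s Ss; have s0 : 0 < s.
  by apply: lt_le_trans Ss; rewrite ltr_wpDl// le_max lexx orbT.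
rewrite extensionE ?(ltW s0)// -ler_pdivlMr//; apply: fM.
by apply: lt_le_trans Ss; rewrite ltr_pwDr// le_max lexx.
Qed.

Lemma admissible_constrained b : admissible L beta f b ->
  constrained L (beta * L) F b.
Proof.
move=> [lb pb b0 fb].
have mFb : measurable_fun [set: R] (F \o b).
  apply: measurableT_comp; last exact: li_measurable.
  by apply: continuous_measurable_fun; exact: extension_continuous.
have fF : (\int[mu]_(x in `[0%R, L]) (f (b x))%:E = \int[mu]_(x in `[0%R, L]) (F (b x))%:E)%E.
  by apply: eq_integral => x _; rewrite extensionE.
rewrite fF in fb.
have I : (\int[mu]_(x in `[0%R, L]) (F (b x))%:E = (beta * L)%:E)%E.
  have Li : 0 < L^-1 by rewrite invr_gt0.
  move: fb; case: (\int[mu]_(x in `[0%R, L]) (F (b x))%:E)%E => [r| |].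
  - by rewrite -EFinM => -[<-]; rewrite mulrAC mulVf ?mul1r// gt_eqF.
  - by rewrite gt0_muley// lte_fin.
  - by rewrite gt0_muleNy// lte_fin.
split => //; last by rewrite /Rintegral I.
apply/integrableP; split; first exact/measurable_EFinP/measurable_funTS.
rewrite integral_fin_num_abs//; last exact: measurable_funTS.
by rewrite I.
Qed.

(** Superlinearity with slope 1 gives [s <= F s + K] for all [s >= 0]: directly beyond [S], and from
    [F s >= F 0] below it. *)
Lemma admissible_int_bound : exists2 C, 0 <= C & forall b, admissible L beta f b ->
  \int[mu]_(x in `[0, L]) b x <= C.
Proof.
have [S S0 FS] := extension_superlinear 1.
pose K := S + `|F 0|.
exists (`|beta * L + K * L|) => // b Ab.
have [lb b0 iF FE] := admissible_constrained Ab.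
apply: le_trans (ler_norm _).
have iK := li_integrable 0 L (li_cst K).
rewrite -FE (_ : K * L = \int[mu]_(x in `[0, L]) K); last by rewrite int_cst ?(ltW L0)// subr0.
rewrite -RintegralD//; apply: le_Rintegral => //.
- exact: li_integrable.
- have i3 : mu.-integrable `[0, L] ((EFin \o (F \o b)) \+ (EFin \o (fun=> K)))%E.
    exact: integrableD iF iK.
  by apply: eq_integrable i3 => // x _; rewrite /= EFinD.
- move=> x _; have := b0 x; set s := b x => s0.
  have [sS|Ss] := leP S s.
    by have := FS _ sS; have := normr_ge0 (F 0); rewrite /K; lra.
  have := extension_homo s0; have := ler_norm (- F 0); rewrite normrN /K; lra.
Qed.

Lemma admissible_extension_le : admissible L beta f !=set0 -> L * F 0 <= beta * L.
Proof.
move=> [b Ab]; have [lb b0 iF FE] := admissible_constrained Ab.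
rewrite -FE (_ : L * F 0 = \int[mu]_(x in `[0, L]) F 0); last first.
  by rewrite int_cst ?(ltW L0)//; ring.
apply: le_Rintegral => //; first exact: (li_integrable 0 L (li_cst (F 0))).
by move=> x _; exact: extension_homo.
Qed.

Lemma periodic_extension_admissible (bs : R -> R) B : measurable_fun [set: R] bs ->
  (forall x, 0 <= bs x <= B) -> \int[mu]_(x in `[0, L]) F (bs x) = beta * L ->
  admissible L beta f (bs \o fold_period L).
Proof.
move=> mbs bsB bsC.
have mb : measurable_fun [set: R] (bs \o fold_period L).
  by apply: measurableT_comp => //; exact: measurable_fold_period.
have mF : measurable_fun [set: R] F.
  by apply: continuous_measurable_fun; exact: extension_continuous.
have FB x : `|F (bs x)| <= `|F 0| + `|F B|.
  have /andP[h1 h2] := bsB x; have := extension_homo h1; have := extension_homo h2.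
  have := ler_norm (- F 0); have := ler_norm (F B); rewrite normrN => ? ? ? ?.
  have := normr_ge0 (F 0); have := normr_ge0 (F B) => ? ?.
  by rewrite ler_norml; apply/andP; split; lra.
have lF : li (fun x => F (bs x)).
  by apply: li_bounded FB; exact: measurableT_comp.
have lFf : li (fun x => F (bs (fold_period L x))).
  by apply: li_bounded (fun x => FB (fold_period L x)); exact: (measurableT_comp mF mb).
split.
- apply: (li_bounded (M := B)) => // x.
  by have /andP[h1 h2] := bsB (fold_period L x); rewrite /= ger0_norm.
- by move=> x; rewrite /= fold_period_periodic.
- by move=> x /=; have /andP[] := bsB (fold_period L x).
- have -> : (\int[mu]_(x in `[0%R, L]) (f ((bs \o fold_period L) x))%:E =
      \int[mu]_(x in `[0%R, L]) (F (bs (fold_period L x)))%:E)%E.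
    apply: eq_integral => x _; rewrite extensionE//=.
    by have /andP[] := bsB (fold_period L x).
  have : \int[mu]_(x in `[0, L]) F (bs (fold_period L x)) = beta * L.
    (* Folding sends the endpoint [L] to 0, hence the comparison on the open interval. *)
    rewrite -bsC; apply: eq_int_oo => // x /andP[h1 h2].
    by rewrite fold_period_id// (ltW h1).
  rewrite /Rintegral => e; rewrite -[X in (_ * X)%E]fineK.
    by rewrite e -EFinM mulrCA mulVf ?mulr1// gt_eqF.
  by apply: integrable_fin_num => //; exact: (li_integrable 0 L lFf).
Qed.

Lemma admissible_linear_maximizer (w : R -> R) W : admissible L beta f !=set0 ->
  continuous w -> (forall x, 0 <= w x <= W) -> (exists2 x : R, 0 <= x <= L & 0 < w x) ->
  exists bs B, [/\ admissible L beta f bs, forall x, 0 <= bs x <= B &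
    forall b, admissible L beta f b ->
      \int[mu]_(x in `[0, L]) (w x * b x) <= \int[mu]_(x in `[0, L]) (w x * bs x)].
Proof.
move=> A0 cw wW wpos.
have [bs [B [mbs bsB bsC bsmax]]] := constrained_maximizer L0 extension_continuous
  extension_homo extension_superlinear cw wW wpos (admissible_extension_le A0).
have Abs := periodic_extension_admissible mbs bsB bsC.
exists (bs \o fold_period L), B; split => // [x|b Ab]; first exact: bsB.
rewrite (@eq_int_oo _ (fun x => w x * (bs \o fold_period L) x) (fun x => w x * bs x)).
- exact/bsmax/admissible_constrained.
- by apply: liM_continuous => //; case: Abs.
- apply: liM_continuous => //; apply: (li_bounded (M := B)) => // x.
  by have /andP[? ?] := bsB x; rewrite ger0_norm.
- by move=> x /andP[h1 h2]; rewrite /= fold_period_id// (ltW h1).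
Qed.

End Constraint.

(** * Maximizing sequences *)

Section MaximizingSequence.
Context {R : realType}.
Notation mu := (@lebesgue_measure R).

(* [sqrt w] is 1/2-Holder with a constant controlled by the dissipation, so
   Ascoli applies. *)
Lemma test_function_cluster (L Dmax : R) (wn dwn : nat -> R -> R) : 0 < L ->
  (forall n, test_function L (wn n) (dwn n)) ->
  (forall n, dissipation L (wn n) (dwn n) <= Dmax) ->
  exists (w : R -> R) (W : R), [/\ continuous w, forall x, 0 <= w x <= W,
    exists2 x : R, 0 <= x <= L & 0 < w x &
    forall e N, 0 < e -> exists2 n, (N <= n)%N & forall x, `|wn n x - w x| <= e].
Proof.
move=> L0 tw dD.
have D0 : 0 <= Dmax by apply: le_trans (dD 0%N); exact: dissipation_ge0 (tw 0%N).
pose W := 2 / L + 2 * L * Dmax.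
have wW n x : 0 <= x <= L -> wn n x <= W.
  move=> xL; have := test_function_le (tw n) L0 (lexx L) xL; move/le_trans; apply.
  by rewrite lerD2l ler_wpM2l// mulr_ge0// ltW.
have W0 : 0 <= W by rewrite addr_ge0// ?mulr_ge0// ?invr_ge0// ltW.
have w0 n x : 0 < wn n x := test_gt0 (tw n) x.
pose K := 4 * W * Dmax.
have K0 : 0 <= K by rewrite !mulr_ge0.
have [||g gP] := @ascoli_cluster R L W wn L0.
- by move=> n x xL; rewrite gtr0_norm// wW.
- move=> e e0; exists (e ^+ 2 / (K + 1)).
    by rewrite divr_gt0 ?exprn_gt0// ltr_wpDl.
  move=> n x y xL yL xy.
  have := test_function_holder (tw n) (wW n) xL yL => h.
  have h' : (wn n x - wn n y) ^+ 2 <= e ^+ 2.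
    apply: le_trans h _.
    have dn0 := dissipation_ge0 (tw n).
    have : 4 * W * dissipation L (wn n) (dwn n) * `|x - y| <= K * `|x - y|.
      by rewrite ler_wpM2r// ler_wpM2l// mulr_ge0.
    move=> /le_trans; apply.
    move: xy; rewrite ltr_pdivlMr; last by rewrite ltr_wpDl.
    by have := normr_ge0 (x - y); lra.
  rewrite -(ler_pXn2r (n := 2))// ?nnegrE ?(ltW e0)//.
  by rewrite real_normK// num_real.
pose w x := g (fold_period L x).
have wP e N : 0 < e -> exists2 n, (N <= n)%N & forall x, `|wn n x - w x| <= e.
  move=> e0; have [n Nn ng] := gP e N e0; exists n => // x.
  rewrite -(periodic_fold x (test_periodic (tw n))); apply: ng.
  by have /andP[-> /ltW->] := fold_period_itv x L0.
exists w, W; split => //.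
- move=> x; apply/continuous_distP => e e0.
  have [|n _ nP] := wP (e / 3) 0%N; first lra.
  have e30 : 0 < e / 3 by lra.
  have cwn : continuous (wn n) := test_fun_continuous (tw n).
  have [d d0 wd] := (continuous_distP (wn n) x).1 (cwn x) _ e30.
  exists d => // t /wd; have := nP t; have := nP x.
  rewrite !ler_norml !ltr_norml => /andP[? ?] /andP[? ?] /andP[? ?].
  by apply/andP; split; lra.
- move=> x; apply/andP; split; apply/ler_addgt0Pl => e e0;
    have [n _ nP] := wP e 0%N e0; have := nP x; have := w0 n x;
    rewrite ler_norml => ? /andP[? ?]; first lra.
  have := wW n (fold_period L x); rewrite (periodic_fold x (test_periodic (tw n))).
  have /andP[-> /ltW->] := fold_period_itv x L0 => /(_ isT) h; lra.
- apply: contrapT => nw.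
  (* If [w <= 0] on the period, some [wn n] would be at most [(2 * L)^-1] there and have mass at
     most 1/2. *)
  have L20 : 0 < (2 * L)^-1 by rewrite invr_gt0 mulr_gt0.
  have [n _ nP] := wP (2 * L)^-1 0%N L20.
  have : \int[mu]_(t in `[0, L]) wn n t <= \int[mu]_(t in `[0, L]) (2 * L)^-1.
    apply: int_le; [|exact: li_cst|].
      exact: li_continuous (test_fun_continuous (tw n)).
    move=> x xL; have wx : w x <= 0.
      by rewrite leNgt; apply/negP => wx; apply: nw; exists x.
    by have := nP x; rewrite ler_norml => /andP[? ?]; lra.
  rewrite (test_mass (tw n)) int_cst ?(ltW L0)// subr0 invfM mulfVK ?gt_eqF//.
  lra.
Qed.

End MaximizingSequence.

Theorem theorem2p1 (R : realType) (L beta : R) (f : R -> R)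
    (L_gt0 : 0 < L) (beta_gt0 : 0 < beta)
    (f_cont : {within `[0, +oo[, continuous f})
    (f_incr : {in `[0, +oo[ &, {homo f : x y / x <= y}})
    (f_superlinear : (f s / s @[s --> +oo] --> +oo))
    (A_nonempty : admissible L beta f !=set0) :
  exists2 bstar : R -> R, admissible L beta f bstar &
    forall b : R -> R, admissible L beta f b ->
      minimal_speed L b <= minimal_speed L bstar.
Proof.
have [C C0 bC] := admissible_int_bound beta L_gt0 f_cont f_incr f_superlinear.
(* The smallness required by [action_le]; [C + 1] avoids inverting 0. *)
pose r := Num.min L (4 * (C + 1))^-1.
have r0 : 0 < r by rewrite lt_min L_gt0 invr_gt0 mulr_gt0// ltr_wpDl.
have rL : r <= L by rewrite ge_min lexx.
have rC : 4 * r * C <= 1.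
  have h : r * (4 * (C + 1)) <= 1.
    by rewrite -ler_pdivlMr ?mulr_gt0 ?ltr_wpDl// mul1r ge_min lexx orbT.
  by move: r0; lra.
have act_le w dw b : test_function L w dw -> admissible L beta f b ->
    action L b w dw <= 2 * C / r - dissipation L w dw / 2.
  move=> tw Ab; have [lb _ b0 _] := Ab.
  exact: (action_le tw lb b0 r0 rL (bC _ Ab) rC).
pose J := [set v : R | exists (w dw b : R -> R), [/\ test_function L w dw,
  admissible L beta f b, 0 <= action L b w dw &
  v = harmonic_ratio L w * action L b w dw]].
have [b0 Ab0] := A_nonempty.
have Jc : exists2 v : R, 0 <= v & J v.
  have [_ _ b00 _] := Ab0; have a0 := action_cst_ge0 L_gt0 b00.
  exists (harmonic_ratio L (fun=> L^-1) * action L b0 (fun=> L^-1) (fun=> 0)).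
    by rewrite harmonic_ratio_cst// mul1r.
  by exists (fun=> L^-1), (fun=> 0), b0; split => //; exact: test_function_cst.
have hJ : has_sup J.
  split; first by have [v _ Jv] := Jc; exists v.
  exists (2 * C / r) => _ [w [dw [b [tw Ab a0 ->]]]].
  have := act_le _ _ _ tw Ab; have := dissipation_ge0 tw => d0 h.
  have : harmonic_ratio L w * action L b w dw <= action L b w dw.
    by rewrite ler_piMl// (harmonic_ratio_le1 L_gt0 tw).
  lra.
pose s := sup J.
have s0 : 0 <= s.
  have [v v0 Jv] := Jc; apply: le_trans v0 _.
  by apply: ub_le_sup => //; case: hJ.
pose ok (n : nat) (v : (R -> R) * (R -> R) * (R -> R)) := let: (w, dw, b) := v in
  [/\ test_function L w dw, admissible L beta f b, 0 <= action L b w dw &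
    s - n.+1%:R^-1 < harmonic_ratio L w * action L b w dw].
have /choice[v vP] : forall n, exists v, ok n v.
  move=> n; have [|_ [w [dw [b [tw Ab a0 ->]]]] h] := sup_adherent (eps := n.+1%:R^-1) _ hJ.
    by rewrite invr_gt0.
  by exists (w, dw, b).
pose wn n := (v n).1.1; pose dwn n := (v n).1.2; pose bn n := (v n).2.
have twn n : test_function L (wn n) (dwn n).
  by have := vP n; rewrite /wn /dwn; case: (v n) => -[w dw] b [].
have Abn n : admissible L beta f (bn n).
  by have := vP n; rewrite /bn; case: (v n) => -[w dw] b [].
have an0 n : 0 <= action L (bn n) (wn n) (dwn n).
  by have := vP n; rewrite /wn /dwn /bn; case: (v n) => -[w dw] b [].
have Jn n : s - n.+1%:R^-1 < harmonic_ratio L (wn n) * action L (bn n) (wn n) (dwn n).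
  by have := vP n; rewrite /wn /dwn /bn; case: (v n) => -[w dw] b [].
have dn n : dissipation L (wn n) (dwn n) <= 4 * C / r.
  by have := act_le _ _ _ (twn n) (Abn n); have := an0 n; lra.
have [w [W [cw wW wpos wP]]] := test_function_cluster L_gt0 twn dn.
have [bs [B [Abs bsB bsmax]]] := admissible_linear_maximizer L_gt0 f_cont f_incr
  f_superlinear A_nonempty cw wW wpos.
(* Both speeds are compared with [2 * sqrt s]: that of [b] lies below by the minimax formula, that
   of [bs] above. *)
exists bs => // b Ab; apply: (@le_trans _ _ (2 * Num.sqrt s)).
  have [c0|c0] := leP (minimal_speed L b) 0.
    by rewrite (le_trans c0)// mulr_ge0// sqrtr_ge0.
  have [lb pb bge0 _] := Ab.
  rewrite -(ler_pXn2r (n := 2))// ?nnegrE ?(ltW c0) ?mulr_ge0 ?sqrtr_ge0//.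
  rewrite exprMn sqr_sqrtr//; apply/ler_addgt0Pl => e e0.
  have [w' [dw' [tw' a0 h]]] := minimal_speed_action L_gt0 lb bge0 c0 e0.
  have : harmonic_ratio L w' * action L b w' dw' <= s.
    by apply: ub_le_sup; [case: hJ|exists w', dw', b].
  by rewrite expr2 in h *; lra.
have [lbs pbs bs0 _] := Abs.
apply: lb_le_inf; first by exists (- principal_eigenvalue L 1 bs / 1); exists 1 => //=.
move=> _ [l l0 <-]; rewrite ler_pdivlMr//.
have [psi [ppsi psi0 eig]] : is_principal_eigenvalue L l bs (principal_eigenvalue L l bs).
  apply: (@xgetPex _ 0 [set k | is_principal_eigenvalue L l bs k]).
  by apply: (principal_eigenvalue_exists L_gt0 l0 _ pbs bsB); case: lbs.
set k := principal_eigenvalue L l bs in eig *.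
have l20 : 0 < 4 * l ^+ 2 by rewrite mulr_gt0// exprn_gt0.
have key eta : 0 < eta -> 0 <= - k + eta /\ 4 * l ^+ 2 * (s - eta) <= (- k + eta) ^+ 2.
  move=> eta0.
  (* Passing from [wn n] to [w] and back costs [e * C] each time, together at most [eta]. *)
  pose e := eta / (2 * C + 1).
  have C1 : 0 < 2 * C + 1 by rewrite ltr_wpDl// mulr_ge0.
  have e0 : 0 < e by rewrite divr_gt0.
  have eC : 2 * e * C <= eta.
    have : e * (2 * C + 1) = eta by rewrite divfK// gt_eqF.
    by lra.
  have [n Nn nw] := wP e (Num.truncn eta^-1) e0.
  have ninv : n.+1%:R^-1 <= eta.
    rewrite -[eta]invrK lef_pV2 ?posrE ?invr_gt0 ?ltr0n//.
    by rewrite ltW// (lt_le_trans (truncnS_gt _))// ler_nat ltnS.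
  have close g : locally_integrable [set: R] g -> (forall x, 0 <= g x) ->
      \int[lebesgue_measure]_(x in `[0, L]) g x <= C ->
      `|\int[lebesgue_measure]_(x in `[0, L]) (wn n x * g x) -
        \int[lebesgue_measure]_(x in `[0, L]) (w x * g x)| <= e * C.
    move=> lg g0 gC; have cwn := test_fun_continuous (twn n).
    have lwg : locally_integrable [set: R] (fun x => w x * g x) by exact: liM_continuous.
    have lwng : locally_integrable [set: R] (fun x => wn n x * g x) by exact: liM_continuous.
    rewrite -intB//; apply: le_trans (int_norm _ _ (liB lwng lwg)) _.
    apply: (@le_trans _ _ (e * \int[lebesgue_measure]_(x in `[0, L]) g x)).
      rewrite -intZ//; apply: int_le; [exact/li_norm/liB|exact: liZ|].
      by move=> x _; rewrite -mulrBl normrM (ger0_norm (g0 x)) ler_wpM2r.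
    by rewrite ler_pM2l.
  have [lbn _ bn0 _] := Abn n.
  have h1 := close bs lbs bs0 (bC _ Abs).
  have h2 := close (bn n) lbn bn0 (bC _ (Abn n)).
  have h3 := bsmax _ (Abn n).
  have h4 := eigenvalue_ge L_gt0 lbs ppsi psi0 eig (twn n).
  (* The dissipations on both sides are equal, so only the linear terms are compared: move to [w],
     use that [bs] maximizes there, and return. *)
  have h5 : action L (bn n) (wn n) (dwn n) - 2 * (e * C) <= action L bs (wn n) (dwn n).
    move: h1 h2; rewrite /action !ler_norml => /andP[? ?] /andP[? ?]; lra.
  have H0 := harmonic_ratio_gt0 L_gt0 (twn n).
  move: (an0 n) (Jn n) h4 h5; set H := harmonic_ratio _ _; set A := action L (bn n) _ _.
  move=> A0 HA h4 h5.
  have lH : 0 <= l ^+ 2 * H by rewrite mulr_ge0 ?sqr_ge0// ltW.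
  have h6 : l ^+ 2 * H + A <= - k + eta by lra.
  have h7 : 0 <= - k + eta by apply: le_trans h6; rewrite addr_ge0.
  split => //.
  apply: (@le_trans _ _ ((l ^+ 2 * H + A) ^+ 2)); last first.
    by rewrite ler_pXn2r ?nnegrE// addr_ge0.
  apply: (@le_trans _ _ (4 * l ^+ 2 * (H * A))).
    by rewrite ler_pM2l//; apply: le_trans (ltW HA); rewrite lerD2l lerN2.
  have : 0 <= (l ^+ 2 * H - A) ^+ 2 by exact: sqr_ge0.
  by clear; move: (l ^+ 2) => z; rewrite !expr2; lra.
have k0 : 0 <= - k.
  by apply/ler_addgt0Pl => eta eta0; rewrite addrC; case: (key eta eta0).
rewrite -(ler_pXn2r (n := 2))// ?nnegrE ?mulr_ge0 ?sqrtr_ge0 ?(ltW l0)//.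
rewrite !exprMn sqr_sqrtr//; apply/ler_addgt0Pl => e e0.
(* The coefficient of [eta] once the square in [key] is expanded, with [eta ^ 2 <= eta]. *)
pose q := 4 * l ^+ 2 + 2 * (- k) + 1.
have q1 : 0 < q by rewrite /q; lra.
pose eta := Num.min 1 (e / q).
have eta0 : 0 < eta by rewrite lt_min ltr01 divr_gt0.
have eta1 : eta <= 1 by rewrite ge_min lexx.
have etaq : eta * q <= e by rewrite -ler_pdivlMr// ge_min lexx orbT.
have [_ h] := key eta eta0.
have e2 : eta * eta <= eta by rewrite ler_piMr// ltW.
move: h etaq; rewrite /q !expr2 => h etaq; lra.
Qed.
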